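(* Let $M$ be a smooth $7$-manifold with a $G_2$-structure $\varphi$ with torsion tensor $T$ and octonionic Dirac operator $\mathcal{D}$. Suppose $V$ is a unit octonion section, and suppose $\tilde\varphi=\sigma_V(\varphi)$ has torsion tensor $\tilde T$. Then $$\mathcal{D}V=\begin{pmatrix}7\tilde\tau_1\\-6\tilde\tau_7\end{pmatrix}V,$$ where $\tilde\tau_1=\frac17\mathrm{Tr}\,\tilde T$ and $\tilde\tau_7=\frac16\tilde T\lrcorner\tilde\varphi$ are the $1$-dimensional and $7$-dimensional components of $\tilde T$, respectively. In particular, $$\mathcal{D}1=\begin{pmatrix}7\tau_1\\-6\tau_7\end{pmatrix},$$ where $\tau_1=\frac17\mathrm{Tr}\,T$ and $\tau_7=\frac16T\lrcorner\varphi$ are the corresponding components of $T$. Here a column denotes the octonion with the given real part (top) and imaginary part (bottom), and the product with $V$ is the octonion product with respect to $\varphi$.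
   Context: Setting. A $G_2$-structure on a smooth $7$-manifold $M$ is identified with a positive $3$-form $\varphi$, i.e. one that at each point lies in the $GL(7,\mathbb{R})$-orbit of $\varphi_0=e^{123}+e^{145}+e^{167}+e^{246}-e^{257}-e^{347}-e^{356}$. It determines a unique Riemannian metric $g$ and volume form $\mathrm{vol}$ (hence an orientation) by $g(u,v)\,\mathrm{vol}=\frac16(u\lrcorner\varphi)\wedge(v\lrcorner\varphi)\wedge\varphi$, where $\lrcorner$ is contraction. Let $*$ be the Hodge star, $\psi=*\varphi$, and $\nabla$ the Levi-Civita connection of $g$. Octonion bundle. $\mathbb{O}M=\Lambda^0\oplus TM$, where $\Lambda^0$ is the trivial real line bundle; an octonion section is $A=(a,\alpha)$ with $a$ a function and $\alpha$ a vector field. $\langle (a,\alpha),(b,\beta)\rangle=ab+g(\alpha,\beta)$; cross product $\langle\alpha\times\beta,\gamma\rangle=\varphi(\alpha,\beta,\gamma)$; octonion product $AB=(ab-\langle\alpha,\beta\rangle,\ a\beta+b\alpha+\alpha\times\beta)$. Torsion and $D$. The torsion tensor $T_{ab}$ of a $G_2$-structure $\varphi$ is the $2$-tensor with $\nabla_a\varphi_{bcd}=2T_a{}^{e}\psi_{ebcd}$; $T_X=(0,X\lrcorner T)$ has vector part $X^aT_a{}^b$. $\mathrm{Tr}\,T=g^{ab}T_{ab}$ and $(T\lrcorner\varphi)^c=T_{ab}\varphi^{abc}$. $\nabla_X(a,\alpha)=(\nabla_Xa,\nabla_X\alpha)$ and $D_XA=\nabla_XA-A\,T_X$. The octonionic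 Dirac operator is $\mathcal{D}A=\delta^i(D_iA)$ with $\delta(X)=(0,X)$, i.e. $\mathcal{D}A=\sum_ie_i(D_{e_i}A)$ for a local orthonormal frame. For a nowhere-vanishing octonion section $A=(a,\alpha)$, $\sigma_A(\varphi)=\frac{1}{|A|^2}\left((a^2-|\alpha|^2)\varphi-2a\,\alpha\lrcorner( *\varphi)+2\alpha\wedge(\alpha\lrcorner\varphi)\right)$ (with $\alpha$ in the wedge product being the dual $1$-form); it is known that this is a $G_2$-structure with the same metric and orientation as $\varphi$. Its torsion is defined by the same formula, using $\sigma_A(\varphi)$ and $*\sigma_A(\varphi)$. *)

(* Defs.v *)
(* All tensor fields are given by their components in the
   charts of an atlas, with the tensorial transformation law on overlaps, and
   indices 0, ..., n-1.  Values of components outside the image of a chart are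
   irrelevant. *)
From HB Require Import structures.
From mathcomp Require Import all_boot all_order all_algebra perm.
From mathcomp Require Import all_classical all_reals all_analysis.

Set Implicit Arguments.
Unset Strict Implicit.
Unset Printing Implicit Defensive.

Import Order.TTheory GRing.Theory Num.Theory.
Import numFieldNormedType.Exports.
Local Open Scope classical_set_scope.
Local Open Scope ring_scope.

Section Calculus.
Variables (R : realType) (n : nat).

Definition partial (i : 'I_n) (f : 'rV[R]_n -> R) : 'rV[R]_n -> R :=
  fun y => 'D_(delta_mx 0 i) f y.

Fixpoint Ck (k : nat) (U : set 'rV[R]_n) (f : 'rV[R]_n -> R) : Prop :=
  (forall y, U y -> {for y, continuous f}) /\
  if k is k'.+1 then
    forall i, (forall y, U y -> derivable f y (delta_mx 0 i)) /\
              Ck k' U (partial i f)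
  else True.

(* meant for open U *)
Definition smooth_on (U : set 'rV[R]_n) (f : 'rV[R]_n -> R) : Prop :=
  forall k, Ck k U f.

End Calculus.

(* A smooth atlas on a Hausdorff second countable space; [param c] is the
   inverse of the chart map [coord c] on [dom c]. *)
Record smooth_manifold (R : realType) (n : nat) := SmoothManifold {
  space :> topologicalType;
  space_hausdorff : hausdorff_space space;
  space_second_countable : @second_countable space;
  chart : Type;
  dom : chart -> set space;
  coord : chart -> space -> 'rV[R]_n;
  param : chart -> 'rV[R]_n -> space;
  chart_cover : forall p, exists c, dom c p;
  dom_open : forall c, open (dom c);
  coord_dom_open : forall c, open (coord c @` dom c);
  coordK : forall c p, dom c p -> param c (coord c p) = p;
  coord_continuous : forall c p, dom c p -> {for p, continuous (coord c)};
  param_continuous : forall c y, (coord c @` dom c) y ->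
    {for y, continuous (param c)};
  transition_smooth : forall c d i,
    smooth_on (coord c @` (dom c `&` dom d))
              (fun y => coord d (param c y) 0 i)
}.

Definition codom_chart (R : realType) (n : nat) (M : smooth_manifold R n)
    (c : chart M) : set 'rV[R]_n :=
  coord c @` dom c.

Section TensorAlgebra.
Variables (R : realType) (n : nat).

(* Components t(e_{i_1}, ..., e_{i_k}) of a covariant k-tensor on R^n. *)
Definition cotensor (k : nat) := k.-tuple 'I_n -> R.

Definition pullback k (J : 'M[R]_n) (t : cotensor k) : cotensor k :=
  fun I => \sum_(K : k.-tuple 'I_n)
    (\prod_(s < k) J (tnth I s) (tnth K s)) * t K.

Definition alternating k (t : cotensor k) : Prop :=
  forall (I : k.-tuple 'I_n) (s : 'S_k),
    t [tuple tnth I (s j) | j < k] = (-1) ^+ s * t I.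

Definition contract k (u : 'rV[R]_n) (t : cotensor k.+1) : cotensor k :=
  fun I => \sum_a u 0 a * t [tuple of a :: I].

(* Normalised so that e^1 /\ ... /\ e^k has value 1 on (e_1, ..., e_k). *)
Definition wedge p q (t : cotensor p) (u : cotensor q) : cotensor (p + q) :=
  fun I => (p`! * q`!)%:R^-1 * \sum_(s : 'S_(p + q)) (-1) ^+ s *
    (t [tuple tnth I (s (lshift q j)) | j < p] *
     u [tuple tnth I (s (rshift p j)) | j < q]).

(* e^{i_1 ... i_k}, with the index convention 1, ..., n of the literature. *)
Definition basic_form k (K : k.-tuple nat) : cotensor k :=
  fun I => \det (\matrix_(s < k, t < k) (tnth K s == (tnth I t).+1)%:R).

Definition gram (g : cotensor 2) : 'M[R]_n := \matrix_(i, j) g [tuple i; j].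

Definition inner (g : cotensor 2) (u v : 'rV[R]_n) : R :=
  (u *m gram g *m v^T) 0 0.

Definition flat (g : cotensor 2) (u : 'rV[R]_n) : cotensor 1 :=
  fun I => \sum_j g [tuple tnth I ord0; j] * u 0 j.

(* all indices raised with g *)
Definition sharp k (g : cotensor 2) (t : cotensor k) : cotensor k :=
  pullback (invmx (gram g)) t.

(* ( * t)_J = 1/k! t^I vol_{I J}, so that t /\ * u = <t, u> vol *)
Definition hodge k l (g : cotensor 2) (vol : cotensor (k + l))
    (t : cotensor k) : cotensor l :=
  fun J => (k`!)%:R^-1 *
    \sum_(I : k.-tuple 'I_n) sharp g t I * vol [tuple of I ++ J].

(* T_a^b *)
Definition endo_of (g T : cotensor 2) : 'M[R]_n := gram T *m invmx (gram g).

Definition trace (g T : cotensor 2) : R :=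
  \sum_a \sum_b invmx (gram g) a b * T [tuple a; b].

(* Symmetric and positive definite. *)
Definition inner_product (g : cotensor 2) : Prop :=
  (forall i j, g [tuple i; j] = g [tuple j; i]) /\
  (forall u, u != 0 -> 0 < inner g u u).

(* vol is one of the two unit n-forms of g. *)
Definition unit_volume (g : cotensor 2) (vol : cotensor n) : Prop :=
  alternating vol /\ vol (ord_tuple n) ^+ 2 = \det (gram g).

End TensorAlgebra.

Section Fields.
Variables (R : realType) (n : nat) (M : smooth_manifold R n).

Definition cotensor_field (k : nat) := chart M -> 'rV[R]_n -> cotensor R n k.

(* Row i is the coordinate vector field d/dx^i of the chart c, in the chart d. *)
Definition jac (c d : chart M) (y : 'rV[R]_n) : 'M[R]_n :=
  \matrix_(i, a) partial i (fun z => coord d (param c z) 0 a) y.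

Definition is_cotensor_field k (t : cotensor_field k) : Prop :=
  (forall c I, smooth_on (codom_chart c) (fun y => t c y I)) /\
  (forall c d p, dom c p -> dom d p ->
     t c (coord c p) = pullback (jac c d (coord c p)) (t d (coord d p))).

Definition is_differential_form k (t : cotensor_field k) : Prop :=
  is_cotensor_field t /\
  (forall c y, codom_chart c y -> alternating (t c y)).

End Fields.

Section LeviCivita.
Variables (R : realType) (n : nat).
Implicit Types (g : 'rV[R]_n -> cotensor R n 2) (y : 'rV[R]_n).

(* Gamma^k_{ij} of the Levi-Civita connection of g *)
Definition christoffel g y (k i j : 'I_n) : R :=
  2^-1 * \sum_l invmx (gram (g y)) k l *
    (partial i (fun z => g z [tuple j; l]) y +
     partial j (fun z => g z [tuple i; l]) y -
     partial l (fun z => g z [tuple i; j]) y).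

Definition nabla_cotensor k g (t : 'rV[R]_n -> cotensor R n k) y (a : 'I_n) :
    cotensor R n k :=
  fun I => partial a (fun z => t z I) y -
    \sum_(s < k) \sum_e christoffel g y e a (tnth I s) *
      t y [tuple if r == s then e else tnth I r | r < k].

Definition nabla_fun (X : 'rV[R]_n) (f : 'rV[R]_n -> R) y : R :=
  \sum_i X 0 i * partial i f y.

Definition nabla_vector g (X : 'rV[R]_n) (v : 'rV[R]_n -> 'rV[R]_n) y :
    'rV[R]_n :=
  \row_k (nabla_fun X (fun z => v z 0 k) y +
          \sum_i \sum_j christoffel g y k i j * X 0 i * v y 0 j).

End LeviCivita.

Section G2.
Variable R : realType.
Local Notation tensor := (cotensor R 7).

Definition phi0 : tensor 3 := fun I =>
  basic_form R [tuple 1; 2; 3]%N I + basic_form R [tuple 1; 4; 5]%N I +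
  basic_form R [tuple 1; 6; 7]%N I + basic_form R [tuple 2; 4; 6]%N I -
  basic_form R [tuple 2; 5; 7]%N I - basic_form R [tuple 3; 4; 7]%N I -
  basic_form R [tuple 3; 5; 6]%N I.

Definition positive_form (phi : tensor 3) : Prop :=
  exists2 A : 'M[R]_7, A \in unitmx & phi = pullback A phi0.

(* g(u,v) vol = 1/6 (u _| phi) /\ (v _| phi) /\ phi *)
Definition metric_equation (phi : tensor 3) (g : tensor 2) (vol : tensor 7) :
    Prop :=
  forall (u v : 'rV[R]_7) (I : 7.-tuple 'I_7),
    inner g u v * vol I =
    6^-1 * wedge (wedge (contract u phi) (contract v phi)) phi I.

Definition octonion : Type := (R * 'rV[R]_7)%type.

Implicit Types (g : tensor 2) (vol : tensor 7) (phi : tensor 3)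
  (A B : octonion).

(* <u x v, w> = phi(u, v, w) *)
Definition cross g phi (u v : 'rV[R]_7) : 'rV[R]_7 :=
  (\row_c contract v (contract u phi) [tuple c]) *m invmx (gram g).

Definition oct_norm2 g A : R := A.1 ^+ 2 + inner g A.2 A.2.

Definition octmul g phi A B : octonion :=
  (A.1 * B.1 - inner g A.2 B.2,
   A.1 *: B.2 + B.1 *: A.2 + cross g phi A.2 B.2).

Definition dual4 g vol phi : tensor 4 := @hodge R 7 3 4 g vol phi.

Definition sigma g vol A phi : tensor 3 := fun I =>
  (oct_norm2 g A)^-1 *
  ((A.1 ^+ 2 - inner g A.2 A.2) * phi I
   - 2 * A.1 * contract A.2 (dual4 g vol phi) I
   + 2 * wedge (flat g A.2) (contract A.2 phi) I).

(* (T _| phi)^c = T_{ab} phi^{abc} *)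
Definition contract_torsion g (T : tensor 2) phi : 'rV[R]_7 :=
  \row_c \sum_a \sum_b T [tuple a; b] * sharp g phi [tuple a; b; c].

Definition tau1 g (T : tensor 2) : R := 7^-1 * trace g T.

Definition tau7 g (T : tensor 2) phi : 'rV[R]_7 :=
  6^-1 *: contract_torsion g T phi.

End G2.

Section OctonionicDirac.
Variable R : realType.
Implicit Types (g T : 'rV[R]_7 -> cotensor R 7 2)
  (phi : 'rV[R]_7 -> cotensor R 7 3) (A : 'rV[R]_7 -> octonion R).

Definition nabla_oct g (X : 'rV[R]_7) A (y : 'rV[R]_7) : octonion R :=
  (nabla_fun X (fun z => (A z).1) y, nabla_vector g X (fun z => (A z).2) y).

Definition oct_derivative g phi T (X : 'rV[R]_7) A y : octonion R :=
  nabla_oct g X A y -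
  octmul (g y) (phi y) (A y) (0, X *m endo_of (g y) (T y)).

(* delta^i (D_i A): row i of the inverse Gram matrix is the coordinate vector
   field with its index raised. *)
Definition dirac g phi T A y : octonion R :=
  \sum_i octmul (g y) (phi y) (0, row i (invmx (gram (g y))))
                (oct_derivative g phi T (delta_mx 0 i) A y).

End OctonionicDirac.

Section G2Manifolds.
Variables (R : realType) (M : smooth_manifold R 7).

Definition is_G2_structure (phi : cotensor_field M 3) : Prop :=
  is_differential_form phi /\
  (forall c y, codom_chart c y -> positive_form (phi c y)).

(* g and vol are the Riemannian metric and volume form determined by phi. *)
Definition is_G2_metric (phi : cotensor_field M 3) (g : cotensor_field M 2)
    (vol : cotensor_field M 7) : Prop :=
  [/\ is_cotensor_field g,
      is_differential_form vol &
      forall c y, codom_chart c y ->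
        [/\ inner_product (g c y), unit_volume (g c y) (vol c y) &
            metric_equation (phi c y) (g c y) (vol c y)]].

(* nabla_a phi_{bcd} = 2 T_a^e psi_{ebcd} with psi = * phi *)
Definition is_torsion (g : cotensor_field M 2) (vol : cotensor_field M 7)
    (phi : cotensor_field M 3) (T : cotensor_field M 2) : Prop :=
  is_cotensor_field T /\
  (forall c y, codom_chart c y -> forall a b i j : 'I_7,
     nabla_cotensor (g c) (phi c) y a [tuple b; i; j] =
     2 * \sum_e endo_of (g c y) (T c y) a e *
           dual4 (g c y) (vol c y) (phi c y) [tuple e; b; i; j]).

Definition octonion_field := chart M -> 'rV[R]_7 -> octonion R.

Definition is_octonion_section (A : octonion_field) : Prop :=
  [/\ forall c, smooth_on (codom_chart c) (fun y => (A c y).1),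
      forall c i, smooth_on (codom_chart c) (fun y => (A c y).2 0 i) &
      forall c d p, dom c p -> dom d p ->
        (A d (coord d p)).1 = (A c (coord c p)).1 /\
        (A d (coord d p)).2 = (A c (coord c p)).2 *m jac c d (coord c p)].

Definition is_unit_section (g : cotensor_field M 2) (A : octonion_field) :
    Prop :=
  forall c y, codom_chart c y -> oct_norm2 (g c y) (A c y) = 1.

Definition sigma_field (g : cotensor_field M 2) (vol : cotensor_field M 7)
    (A : octonion_field) (phi : cotensor_field M 3) : cotensor_field M 3 :=
  fun c y => sigma (g c y) (vol c y) (A c y) (phi c y).

Definition dirac_field (g : cotensor_field M 2) (phi : cotensor_field M 3)
    (T : cotensor_field M 2) (A : octonion_field) : octonion_field :=
  fun c => dirac (g c) (phi c) (T c) (A c).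

Definition octmul_field (g : cotensor_field M 2) (phi : cotensor_field M 3)
    (A B : octonion_field) : octonion_field :=
  fun c y => octmul (g c y) (phi c y) (A c y) (B c y).

Definition one_section : octonion_field := fun _ _ => (1, 0).

(* the octonion with components 7 tau_1 and - 6 tau_7 *)
Definition torsion_octonion (g : cotensor_field M 2) (T : cotensor_field M 2)
    (phi : cotensor_field M 3) : octonion_field :=
  fun c y => (7 * tau1 (g c y) (T c y),
              (- 6) *: tau7 (g c y) (T c y) (phi c y)).

Definition same_section (A B : octonion_field) : Prop :=
  forall c y, codom_chart c y -> A c y = B c y.

End G2Manifolds.

(* Main.v *)
(* At each point a G2-structure is phi = A^* phi0 for a frame A, and the metric
   equation forces g = A A^T and vol = det A e^{1...7}; so octonion identities
   reduce to polynomial identities for phi0.  The main one is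
   x (y V) = (x o y) V for a unit octonion V, where o is the product of
   sigma_V(phi).  For an imaginary unit w, sigma_w(phi) is the pullback of phi by
   the rotation x |-> 2 <x, w> w - x; a unit V is a product of two imaginary
   units, so sigma_V(phi) is again a G2-structure with the same g and vol.

   The torsion T measures the failure of the Leibniz rule: since twice
   T_X _| psi is an associator, nabla_X (A B) = (nabla_X A) B + A (nabla_X B) +
   (A B) T_X - A (B T_X).  Differentiating x (y V) = (x o y) V with this rule for
   both products gives D_X V = - Tt_X V, hence the Dirac operator of V is
   - sum e_i (Tt_i V) = - (sum e_i o Tt_i) V. *)
From Stdlib Require Import ZArith.
From mathcomp Require Import all_boot all_order all_algebra perm.
From mathcomp Require Import all_classical all_reals all_analysis.
From mathcomp Require Import ring lra ssrZ.
Require Import Defs.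

Set Implicit Arguments.
Unset Strict Implicit.
Unset Printing Implicit Defensive.

Import Order.TTheory GRing.Theory Num.Theory.
Import numFieldNormedType.Exports.
Local Open Scope ring_scope.

(** Two obstacles shape the proof. First, [wedge], [hodge] and the determinants in [basic_form] run
    over all permutations, up to 7! of them, and do not evaluate as written. They are recast as
    nested subtractions over lists; the same recursion runs in [Z], where the facts about phi0 are
    computed and then carried to [R] by [zR]. The main ones are the metric equation on basis
    vectors, 2 psi0 as the coefficient array of the associator, and the injectivity of t |-> t _|
    psi0. Identities with free octonions are polynomial in coordinates and are left to [ring].
    Second, the torsion of sigma_V(phi) involves its derivative, yet its formula contains a Hodge
    star of a varying metric. That formula is never differentiated: the components are read off from
    x(yV) times the conjugate of V, and the Leibniz rule is proved for an arbitrary 3-tensor.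
    Finally, Tt_X is identified by comparing associators: |V| = 1 makes D_X V times the conjugate of
    V imaginary, hence a vector, and a vector t is determined by its contraction with the dual of
    sigma_V(phi). *)

Section Tensors.
Variables (R : realType) (n : nat).
Local Notation tensor := (cotensor R n).

(** * Pullback of covariant tensors along a matrix *)

Lemma big_tuple_cons (V : nmodType) (T : finType) k (F : k.+1.-tuple T -> V) :
  \sum_K F K = \sum_a \sum_(K : k.-tuple T) F [tuple of a :: K].
Proof.
rewrite pair_big /=.
rewrite (reindex (fun p : T * k.-tuple T => [tuple of p.1 :: p.2])) //=.
exists (fun K => (thead K, [tuple of behead K])) => [[a K] _|K _] /=.
  by congr pair; apply/val_inj.
by rewrite [RHS]tuple_eta.
Qed.

Lemma big_tuple0 (V : nmodType) (T : finType) (F : 0.-tuple T -> V) :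
  \sum_K F K = F [tuple].
Proof. by rewrite (big_pred1 [tuple]) // => K; apply/esym/eqP/tuple0. Qed.

Lemma big_tuple_cat (V : nmodType) (T : finType) p q (F : (p + q).-tuple T -> V) :
  \sum_K F K = \sum_(K : p.-tuple T) \sum_(L : q.-tuple T) F [tuple of K ++ L].
Proof.
rewrite pair_big /=.
rewrite (reindex (fun x : p.-tuple T * q.-tuple T => [tuple of x.1 ++ x.2])) //=.
exists (fun K => ([tuple tnth K (lshift q j) | j < p],
                  [tuple tnth K (rshift p j) | j < q])) => [[K L] _|K _] /=.
  by congr pair; apply/eq_from_tnth => j; rewrite tnth_mktuple ?tnth_lshift ?tnth_rshift.
apply/eq_from_tnth => j; rewrite -[j]splitK; case: (fintype.split j) => i /=.
  by rewrite tnth_lshift tnth_mktuple.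
by rewrite tnth_rshift tnth_mktuple.
Qed.

Lemma pullback_comp k (P Q : 'M[R]_n) (t : tensor k) :
  pullback P (pullback Q t) = pullback (P *m Q) t.
Proof.
apply/funext => I; rewrite /pullback.
under eq_bigr => K _ do rewrite mulr_sumr.
rewrite exchange_big /=; apply: eq_bigr => L _.
under eq_bigr => K _ do rewrite mulrA -big_split /=.
rewrite -mulr_suml; congr (_ * _).
under [RHS]eq_bigr => s _ do rewrite mxE.
rewrite bigA_distr_bigA /=.
rewrite (reindex (fun f : {ffun 'I_k -> 'I_n} => [tuple f i | i < k])) /=.
  by apply: eq_bigr => f _; apply: eq_bigr => s _; rewrite tnth_mktuple.
exists (fun K => [ffun s => tnth K s]) => [f _|K _].
  by apply/ffunP => s; rewrite ffunE tnth_mktuple.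
by apply/eq_from_tnth => s; rewrite tnth_mktuple ffunE.
Qed.

Lemma prod_tuple_delta k (I K : k.-tuple 'I_n) :
  \prod_(s < k) ((tnth I s == tnth K s)%:R : R) = (I == K)%:R.
Proof.
case: eqP => [->|/eqP neq]; first by rewrite big1 // => s _; rewrite eqxx.
have [s hs] : exists s, tnth I s != tnth K s.
  apply/existsP; apply: contraNT neq => /existsPn h.
  by apply/eqP/eq_from_tnth => s; apply/eqP; move: (h s); rewrite negbK.
by rewrite (bigD1 s) //= (negbTE hs) mul0r.
Qed.

Lemma pullback1 k (t : tensor k) : pullback 1%:M t = t.
Proof.
apply/funext => I; rewrite /pullback (bigD1 I) //= [X in X * _]big1 => [|s _]; last
  by rewrite mxE eqxx.
rewrite mul1r [X in _ + X]big1 ?addr0 // => K /negPf nK.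
under eq_bigr => s _ do rewrite mxE.
by rewrite prod_tuple_delta eq_sym nK mul0r.
Qed.

(** Used for the Hodge star, where it moves the matrix acting on the form over to the volume
    form. *)
Lemma pullback_sum_adjoint k (P : 'M[R]_n) (t u : tensor k) :
  \sum_I pullback P t I * u I = \sum_I t I * pullback P^T u I.
Proof.
rewrite /pullback.
under eq_bigr => I _ do rewrite mulr_suml.
rewrite exchange_big /=; apply: eq_bigr => K _; rewrite mulr_sumr.
apply: eq_bigr => I _; rewrite mulrA [t K * _]mulrC; congr (_ * _ * _).
by apply: eq_bigr => s _; rewrite mxE.
Qed.

Lemma contract_pullback k (J : 'M[R]_n) (u : 'rV[R]_n) (t : tensor k.+1) :
  contract u (pullback J t) = pullback J (contract (u *m J) t).
Proof.
apply/funext => I; rewrite /contract /pullback.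
under eq_bigr => a _ do rewrite big_tuple_cons mulr_sumr.
rewrite exchange_big /=.
under [RHS]eq_bigr => K _ do rewrite mulr_sumr.
rewrite [RHS]exchange_big /=; apply: eq_bigr => b _.
under eq_bigr => a _ do rewrite mulr_sumr.
rewrite exchange_big /=; apply: eq_bigr => K _.
rewrite !mxE mulr_suml mulr_sumr; apply: eq_bigr => a _.
rewrite big_ord_recl /=.
rewrite -[in LHS](_ : a = tnth [tuple of a :: I] ord0) //.
rewrite -[in LHS](_ : b = tnth [tuple of b :: K] ord0) //.
have -> : \prod_(i < k) J (tnth [tuple of a :: I] (lift ord0 i))
   (tnth [tuple of b :: K] (lift ord0 i)) = \prod_(s < k) J (tnth I s) (tnth K s).
  by apply: eq_bigr => s _; rewrite !tnthS.
by rewrite [in RHS]mulrCA !mulrA.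
Qed.

Lemma pullback_vector (J : 'M[R]_n) (t : tensor 1) a :
  pullback J t [tuple a] = \sum_b J a b * t [tuple b].
Proof.
rewrite /pullback big_tuple_cons; apply: eq_bigr => b _.
by rewrite big_tuple0 big_ord_recl big_ord0 mulr1.
Qed.

Lemma pullbackD k (J : 'M[R]_n) (t u : tensor k) I :
  pullback J (fun I => t I + u I) I = pullback J t I + pullback J u I.
Proof.
by rewrite /pullback -big_split; apply: eq_bigr => K _; rewrite mulrDr.
Qed.

Lemma pullbackZ k (J : 'M[R]_n) c (t : tensor k) I :
  pullback J (fun I => c * t I) I = c * pullback J t I.
Proof.
by rewrite /pullback mulr_sumr; apply: eq_bigr => K _; rewrite mulrCA.
Qed.

Lemma pullback_wedge p q (J : 'M[R]_n) (t : tensor p) (u : tensor q) :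
  wedge (pullback J t) (pullback J u) = pullback J (wedge t u).
Proof.
apply/funext => I; rewrite /wedge pullbackZ; congr (_ * _).
rewrite {3}/pullback.
under [RHS]eq_bigr => K _ do rewrite mulr_sumr.
rewrite [RHS]exchange_big /=; apply: eq_bigr => s _.
(* Relabelling the summation index by s^-1 undoes the shuffle s, so that the two factors read the
   first p and the last q slots. *)
pose f (K : (p + q).-tuple 'I_n) := [tuple tnth K (s^-1%g j) | j < p + q].
have fK K j : tnth (f K) (s j) = tnth K j by rewrite tnth_mktuple permK.
rewrite [RHS](reindex f) /=; last first.
  exists (fun K => [tuple tnth K (s j) | j < p + q]) => K _.
    by apply/eq_from_tnth => j; rewrite tnth_mktuple fK.
  by apply/eq_from_tnth => j; rewrite !tnth_mktuple permKV.
under [RHS]eq_bigr => K _.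
  rewrite mulrCA; over.
rewrite -mulr_sumr; congr (_ * _).
rewrite big_tuple_cat /pullback mulr_suml; apply: eq_bigr => K _.
rewrite mulr_sumr; apply: eq_bigr => L _.
rewrite (reindex_inj (@perm_inj _ s)) /= big_split_ord /=.
have -> : [tuple tnth (f [tuple of K ++ L]) (s (lshift q j)) | j < p] = K.
  by apply/eq_from_tnth => j; rewrite tnth_mktuple fK tnth_lshift.
have -> : [tuple tnth (f [tuple of K ++ L]) (s (rshift p j)) | j < q] = L.
  by apply/eq_from_tnth => j; rewrite tnth_mktuple fK tnth_rshift.
rewrite mulrACA; congr (_ * _ * _); apply: eq_bigr => j _.
  by rewrite fK tnth_lshift tnth_mktuple.
by rewrite fK tnth_rshift tnth_mktuple.
Qed.

Lemma flat_pullback (J : 'M[R]_n) (g h : tensor 2) (u : 'rV[R]_n) :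
  gram g = J *m gram h *m J^T ->
  flat g u = pullback J (flat h (u *m J)).
Proof.
move=> Eg; apply/funext => I; have -> : I = [tuple thead I].
  by rewrite {1}[I]tuple_eta; apply/val_inj => /=; congr cons; apply/size0nil; rewrite size_tuple.
have flatE (k : tensor 2) v i : flat k v [tuple i] = (gram k *m v^T) i 0.
  by rewrite /flat mxE; apply: eq_bigr => j _; rewrite !mxE.
rewrite flatE; set i := thead I.
rewrite pullback_vector Eg -mulmxA -trmx_mul -mulmxA mxE; apply: eq_bigr => b _; congr (_ * _).
by rewrite flatE.
Qed.

Lemma inner_pullback (J : 'M[R]_n) (g h : tensor 2) (u v : 'rV[R]_n) :
  gram g = J *m gram h *m J^T ->
  inner g u v = inner h (u *m J) (v *m J).
Proof. by move=> Eg; rewrite /inner Eg trmx_mul !mulmxA. Qed.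

End Tensors.

(** * The alternating symbol and forms of top degree *)

Section LeviCivitaSymbol.
Variables (R : realType) (n : nat).

Definition levi_civita : cotensor R n n :=
  fun I => \det (\matrix_(i, j) (tnth I i == j)%:R).

Lemma levi_civita_sum I :
  levi_civita I = \sum_(s : 'S_n) (-1) ^+ s * (I == [tuple s j | j < n])%:R.
Proof.
apply: eq_bigr => s _; congr (_ * _); rewrite -prod_tuple_delta.
by apply: eq_bigr => j _; rewrite mxE tnth_mktuple.
Qed.

Lemma pullback_levi_civita (A : 'M[R]_n) :
  pullback A levi_civita = fun I => \det A * levi_civita I.
Proof.
apply/funext => I; rewrite mulrC -det_mulmx /pullback.
under eq_bigr => K _ do rewrite levi_civita_sum mulr_sumr.
rewrite exchange_big /=; apply: eq_bigr => s _.
rewrite (bigD1 [tuple s j | j < n]) //= eqxx mulr1 [X in _ + X]big1.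
  rewrite addr0 mulrC; congr (_ * _); apply: eq_bigr => i _.
  rewrite tnth_mktuple mxE (bigD1 (tnth I i)) //= mxE eqxx mul1r.
  by rewrite big1 ?addr0 // => k /negPf nk; rewrite mxE eq_sym nk mul0r.
by move=> K /negPf ->; rewrite !mulr0.
Qed.

Lemma alternating_top (t : cotensor R n n) I :
  alternating t -> t I = t (ord_tuple n) * levi_civita I.
Proof.
move=> alt_t; case: (boolP (injectiveb (tnth I))) => [/injectiveP inj|].
  have EI : I = [tuple tnth (ord_tuple n) (perm inj j) | j < n].
    by apply/eq_from_tnth => j; rewrite tnth_mktuple tnth_ord_tuple permE.
  rewrite {1}EI alt_t mulrC; congr (_ * _).
  rewrite -det_perm; congr (\det _); apply/matrixP => i j.
  by rewrite !mxE permE.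
case/injectivePn => i [j nij Eij].
(* Swapping two equal entries fixes I but changes the sign. *)
have := alt_t I (tperm i j); rewrite odd_tperm nij expr1 mulN1r.
have -> : [tuple tnth I (tperm i j k) | k < n] = I.
  by apply/eq_from_tnth => k; rewrite tnth_mktuple; case: tpermP => // ->.
move=> tI; have -> : t I = 0 by lra.
rewrite (_ : levi_civita I = 0) ?mulr0 //.
apply: (determinant_alternate (i1 := i) (i2 := j))=> // k.
by rewrite !mxE Eij.
Qed.

End LeviCivitaSymbol.

Lemma wedge_alternating (R : realType) n p q (t : cotensor R n p) (u : cotensor R n q) :
  alternating (wedge t u).
Proof.
move=> I s; rewrite /wedge mulrCA; congr (_ * _); rewrite mulr_sumr.
rewrite (reindex_inj (mulIg s^-1%g)) /=; apply: eq_bigr => r _.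
rewrite odd_permM odd_permV signr_addb -mulrA mulrCA; congr (_ * (_ * (_ * _))).
  by congr t; apply/eq_from_tnth => j; rewrite !tnth_mktuple permM permKV.
by congr u; apply/eq_from_tnth => j; rewrite !tnth_mktuple permM permKV.
Qed.

(** * Sums over permutations as recursions on lists *)

Section SignedSums.

(** Permutations are sorted by the image j of 0; what remains is a permutation of n points. [ulsf]
    removes a point and its image, which inverts [lift_perm]. *)
Lemma sum_lift_perm (V : nmodType) n (F : 'S_n.+1 -> V) :
  \sum_s F s = \sum_j \sum_(s : 'S_n) F (lift_perm ord0 j s).
Proof.
rewrite (partition_big (fun s : 'S_n.+1 => s ord0) predT) //=.
apply: eq_bigr => j0 _; rewrite (reindex (lift_perm ord0 j0)) /=.
  by apply: eq_bigl => s; rewrite lift_perm_id eqxx.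
pose ulsf i (s : 'S_n.+1) k := odflt k (unlift (s i) (s (lift i k))).
have ulsfK i (s : 'S_n.+1) k : lift (s i) (ulsf i s k) = s (lift i k).
  rewrite /ulsf; have := neq_lift i k.
  by rewrite -(can_eq (permK s)) => /unlift_some[] ? ? ->.
have inj_ulsf : injective (ulsf ord0 _).
  move=> s; apply: can_inj (ulsf (s ord0) s^-1%g) _ => k'.
  by rewrite {1}/ulsf ulsfK !permK liftK.
exists (fun s => perm (inj_ulsf s)) => [s _ | s].
  by apply/permP=> k'; rewrite permE /ulsf lift_perm_lift lift_perm_id liftK.
move/(s _ =P _) => si0; apply/permP=> k.
case: (unliftP ord0 k) => [k'|] ->; rewrite ?lift_perm_id //.
by rewrite lift_perm_lift -si0 permE ulsfK.
Qed.

Fixpoint picks (T : Type) (l : seq T) : seq (T * seq T) :=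
  if l is x :: l' then (x, l') :: [seq (p.1, x :: p.2) | p <- picks l'] else [::].

(* [sub] and [zero] are parameters so that the same recursion computes in [Z];
   the alternating signs come from the nested subtractions. *)
Fixpoint signed_sum (T V : Type) (sub : V -> V -> V) (zero : V) (n : nat)
    (l : seq T) (F : seq T -> V) : V :=
  if n is n'.+1 then
    foldr (fun p acc => sub (signed_sum sub zero n' p.2 (fun r => F (p.1 :: r))) acc)
      zero (picks l)
  else F [::].

Lemma size_picks (T : Type) (l : seq T) : size (picks l) = size l.
Proof. by elim: l => //= x l <-; rewrite size_map. Qed.

Lemma nth_picks (T : Type) (x0 : T) (l : seq T) j : (j < size l)%N ->
  nth (x0, [::]) (picks l) j = (nth x0 l j, take j l ++ drop j.+1 l).
Proof.
elim: l j => [|x l IH] [|j] //=; rewrite ?drop0 // ltnS => jl.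
by rewrite (nth_map (x0, [::])) ?size_picks // IH.
Qed.

Lemma foldr_sub (V : zmodType) (T : Type) (x0 : T) (f : T -> V) (l : seq T) :
  foldr (fun p acc => f p - acc) 0 l = \sum_(j < size l) (f (nth x0 l j)) *~ (-1) ^+ j.
Proof.
elim: l => [|x l IH] /=; first by rewrite big_ord0.
rewrite big_ord_recl /= IH -sumrN; congr (_ + _); apply: eq_bigr => j _.
by rewrite exprS mulN1r mulrNz.
Qed.

(** Induction along [sum_lift_perm]: the first choice j contributes the sign (-1)^j, supplied by the
    nested subtraction, and the rest permutes the list without that entry. *)
Lemma sum_permE (R : pzRingType) (T : Type) (x0 : T) n (l : seq T) (F : seq T -> R) :
  size l = n ->
  \sum_(s : 'S_n) (-1) ^+ s * F [seq nth x0 l (s i) | i <- enum 'I_n] =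
  signed_sum (fun x y => x - y) 0 n l F.
Proof.
elim: n l F => [|n IH] l F sl.
  rewrite (big_pred1 (1%g : 'S_0)) => [|s]; last by apply/esym/eqP/permP => -[].
  by rewrite odd_perm1 mul1r /= enum_ord0.
rewrite sum_lift_perm /= (foldr_sub (x0, [::])) size_picks sl.
apply: eq_bigr => j _; have jl : (j < size l)%N by rewrite sl.
rewrite (nth_picks x0) //= -IH; last first.
  by rewrite size_cat size_take size_drop jl sl subSS subnKC // -ltnS.
have -> z : z *~ (-1) ^+ j = (-1) ^+ j * z :> R.
  by rewrite -mulrzl rmorphXn /= rmorphN rmorph1.
rewrite mulr_sumr; apply: eq_bigr => s _.
rewrite odd_lift_perm addFb signr_addb signr_odd mulrA; congr (_ * F _).
rewrite enum_ordSl /= lift_perm_id -map_comp; congr cons.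
apply: eq_map => i /=; rewrite lift_perm_lift /= nth_cat size_take jl.
(* [lift] skips position j exactly as [take j l ++ drop j.+1 l] does. *)
rewrite /bump; case: (leqP j (s i)) => h.
  by rewrite nth_drop addSn subnKC.
by rewrite nth_take.
Qed.

(** Only differences and zero have to be preserved, so [f] may be a rescaled ring morphism; this
    carries values computed in [Z] over to [R]. *)
Lemma signed_sum_morph (T V W : Type) (f : V -> W) subV zV subW zW n (l : seq T) F G :
  (forall x y, f (subV x y) = subW (f x) (f y)) -> f zV = zW ->
  (forall r, f (F r) = G r) ->
  f (signed_sum subV zV n l F) = signed_sum subW zW n l G.
Proof.
move=> fB f0; elim: n l F G => [|n IH] l F G FG //=.
elim: (picks l) => //= p ps IHp; rewrite fB IHp; congr subW.
exact: IH.
Qed.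

End SignedSums.

Delimit Scope Z_scope with stdZ.

(** * Facts about phi0 checked over the integers *)

Section IntegerModel.

Definition sumZ (T : Type) (l : seq T) (f : T -> Z) : Z :=
  foldr (fun i acc => Z.add (f i) acc) Z0 l.

(* 0 when [I] is not an ordering of [l] *)
Fixpoint epsilonZ (l I : seq nat) : Z :=
  if I is a :: I' then
    foldr (fun p acc => Z.sub (if p.1 == a then epsilonZ p.2 I' else Z0) acc)
      Z0 (picks l)
  else 1%stdZ.

(* 0-based, unlike the indices of [basic_form] *)
Definition phi_triples : seq (seq nat * Z) :=
  [:: ([:: 0; 1; 2], 1%stdZ); ([:: 0; 3; 4], 1%stdZ); ([:: 0; 5; 6], 1%stdZ);
      ([:: 1; 3; 5], 1%stdZ); ([:: 1; 4; 6], (-1)%stdZ); ([:: 2; 3; 6], (-1)%stdZ);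
      ([:: 2; 4; 5], (-1)%stdZ)]%N.

(** Evaluated once and stored, so that the checks below look components up instead of recomputing
    signs. *)
Definition phi_table : seq (seq (seq Z)) := Eval vm_compute in
  [seq [seq [seq sumZ phi_triples (fun p => Z.mul p.2 (epsilonZ [:: i; j; k] p.1))
    | k <- iota 0 7] | j <- iota 0 7] | i <- iota 0 7].

Definition phiZ (i j k : nat) : Z :=
  nth Z0 (nth [::] (nth [::] phi_table i) j) k.

Definition all7 (P : nat -> bool) := all P (iota 0 7).

Lemma phi_tableP : all7 (fun i => all7 (fun j => all7 (fun k =>
  Z.eqb (phiZ i j k)
    (sumZ phi_triples (fun p => Z.mul p.2 (epsilonZ [:: i; j; k] p.1)))))).
Proof. by vm_compute. Qed.

(** Only 42 of the 343 components are nonzero, which keeps the sum defining [hodgeZ] short. *)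
Definition phi_terms : seq (nat * nat * nat) := Eval vm_compute in
  [seq p <- [seq (p, k) | p <- [seq (i, j) | i <- iota 0 7, j <- iota 0 7], k <- iota 0 7]
     | ~~ Z.eqb (phiZ p.1.1 p.1.2 p.2) Z0].

Definition deltaZ (i j : nat) : Z := if i == j then 1%stdZ else 0%stdZ.

(* The factor [phi] on the last three slots is tested first, so that most of
   the 7! orderings cost nothing. *)
Definition metric_summandZ (a b : nat) (l : seq nat) : Z :=
  (let m := drop 4 l in
  let c := phiZ (nth 0 m 0) (nth 0 m 1) (nth 0 m 2) in
  if Z.eqb c Z0 then Z0 else
  Z.mul (signed_sum Z.sub Z0 (2 + 2) (take 4 l) (fun r =>
    Z.mul (phiZ a (nth 0 (take 2 r) 0) (nth 0 (take 2 r) 1))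
          (phiZ b (nth 0 (drop 2 r) 0) (nth 0 (drop 2 r) 1)))) c)%N.

Definition metricZ (a b : nat) : Z :=
  signed_sum Z.sub Z0 7 (iota 0 7) (metric_summandZ a b).

(* 24 * 6 = 4! 3! and 2 * 2 = 2! 2! undo the normalisations of the two nested wedges. *)
Lemma metricZP : all7 (fun a => all7 (fun b =>
  Z.eqb (metricZ a b) (6 * ((24 * 6) * (2 * 2)) * deltaZ a b)%stdZ)).
Proof. by vm_compute. Qed.

(* six times the Hodge dual of [phi0] *)
Definition hodgeZ (i j k l : nat) : Z :=
  sumZ phi_terms (fun p => Z.mul (phiZ p.1.1 p.1.2 p.2)
    (epsilonZ (iota 0 7) [:: p.1.1; p.1.2; p.2; i; j; k; l])).

(* the coefficient of t_t a_a b_b e_d in (a b) t - a (b t), for imaginary octonions *)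
Definition associatorZ (t a b d : nat) : Z :=
  Z.sub (Z.sub (sumZ (iota 0 7) (fun e => Z.mul (phiZ a b e) (phiZ e t d)))
               (Z.mul (deltaZ a b) (deltaZ t d)))
        (Z.sub (sumZ (iota 0 7) (fun e => Z.mul (phiZ b t e) (phiZ a e d)))
               (Z.mul (deltaZ b t) (deltaZ a d))).

(** Component by component, 2 psi0(t, a, b, .) is the associator (ab)t - a(bt). The factor 3 is 6/2,
    since [hodgeZ] omits the division by 3!. *)
Lemma hodgeZP : all7 (fun t => all7 (fun a => all7 (fun b => all7 (fun d =>
  Z.eqb (hodgeZ t a b d) (Z.mul 3%stdZ (associatorZ t a b d)))))).
Proof. by vm_compute. Qed.

Lemma all7P (P : nat -> bool) (i : 'I_7) : all7 P -> P i.
Proof. by move=> /allP; apply; rewrite mem_iota /=. Qed.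

Lemma metricZE (a b : 'I_7) :
  signed_sum Z.sub Z0 7 (iota 0 7) (metric_summandZ a b) =
  (6 * ((24 * 6) * (2 * 2)) * deltaZ a b)%stdZ.
Proof.
have := all7P b (all7P a metricZP); cbv beta; move/Z.eqb_eq.
by unfold metricZ.
Qed.

Lemma hodgeZE (t a b d : 'I_7) :
  hodgeZ t a b d = Z.mul 3%stdZ (associatorZ t a b d).
Proof.
by have := all7P d (all7P b (all7P a (all7P t hodgeZP))); cbv beta; move/Z.eqb_eq.
Qed.

End IntegerModel.

(** * Transfer from the integers to the real numbers *)

Section RealModel.
Variable R : realType.
Local Notation tensor := (cotensor R 7).

Definition zR (z : Z) : R := (int_of_Z z)%:~R.

Lemma zR0 : zR Z0 = 0. Proof. by []. Qed.
Lemma zR1 : zR 1%stdZ = 1. Proof. by []. Qed.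
Lemma zRD x y : zR (Z.add x y) = zR x + zR y.
Proof. by rewrite /zR (rmorphD int_of_Z) rmorphD. Qed.
Lemma zRB x y : zR (Z.sub x y) = zR x - zR y.
Proof. by rewrite /zR (rmorphB int_of_Z) rmorphB. Qed.
Lemma zRM x y : zR (Z.mul x y) = zR x * zR y.
Proof. by rewrite /zR (rmorphM int_of_Z) rmorphM. Qed.

Lemma zR_sum (T : Type) (l : seq T) f : zR (sumZ l f) = \sum_(i <- l) zR (f i).
Proof.
elim: l => [|i l IH]; first by rewrite big_nil.
by rewrite big_cons /= zRD IH.
Qed.

Lemma zR_delta (i j : 'I_7) : zR (deltaZ i j) = (i == j)%:R.
Proof. by rewrite /deltaZ -val_eqE; case: eqP. Qed.

Lemma signed_sum_epsilonZ n (l J : seq nat) : size J = n ->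
  signed_sum (fun x y => x - y) 0 n l (fun r => (r == J)%:R) = zR (epsilonZ l J).
Proof.
elim: n l J => [|n IH] l [|a J] //= [sJ].
elim: (picks l) => //= p ps ->; rewrite zRB; congr (_ - _).
case: eqP => [->|ne].
  by rewrite -IH //; congr signed_sum; apply/funext => r; rewrite eqseq_cons eqxx.
(* If the first pick is not a, the list can no longer equal a :: J and the inner sum vanishes. *)
have z0 m k : signed_sum (fun x y : R => x - y) 0 m (k : seq nat) (fun=> 0) = 0.
  elim: m k => //= m IHm k; elim: (picks k) => //= q qs ->.
  by rewrite IHm subr0.
rewrite -[RHS](z0 n p.2); congr signed_sum; apply/funext => r.
by rewrite eqseq_cons; case: eqP.
Qed.

Lemma sum_perm_epsilonZ n (l J : seq nat) : size l = n -> size J = n ->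
  \sum_(s : 'S_n) (-1) ^+ s * ([seq nth 0%N l (s i) | i <- enum 'I_n] == J)%:R =
  zR (epsilonZ l J).
Proof.
by move=> sl sJ; rewrite (sum_permE 0%N (fun r => (r == J)%:R) sl) signed_sum_epsilonZ.
Qed.

Lemma levi_civitaE n (I : n.-tuple 'I_n) :
  levi_civita R I = zR (epsilonZ (iota 0 n) (map val I)).
Proof.
rewrite levi_civita_sum -(@sum_perm_epsilonZ n) ?size_iota ?size_map ?size_tuple //.
apply: eq_bigr => s _; congr (_ * _%:R).
have -> : [seq nth 0%N (iota 0 n) (s i) | i <- enum 'I_n] = map val [tuple s j | j < n].
  by rewrite /= -map_comp; apply: eq_map => i /=; rewrite nth_iota.
by rewrite eq_sym (inj_eq (inj_map val_inj)) -val_eqE.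
Qed.

Lemma basic_formE k (K : k.-tuple nat) (I : k.-tuple 'I_7) (J : seq nat) :
  map succn J = K -> basic_form R K I = zR (epsilonZ (map val I) J).
Proof.
move=> JK; have sJ : size J = k by rewrite -(size_map succn) JK size_tuple.
rewrite -(@sum_perm_epsilonZ k) ?size_map ?size_tuple //.
apply: eq_bigr => s _; congr (_ * _).
have -> : [seq nth 0%N (map val I) (s i) | i <- enum 'I_k] =
    map val [tuple tnth I (s i) | i < k].
  rewrite /= -map_comp; apply: eq_map => i /=.
  by rewrite (nth_map (tnth I i)) ?size_tuple // [in RHS](tnth_nth (tnth I i)).
rewrite -(inj_eq (inj_map succn_inj)) JK -map_comp eq_sym.
have -> : map (succn \o val) [tuple tnth I (s i) | i < k] =
  [tuple (tnth I (s i)).+1 | i < k] :> seq nat by rewrite /= -map_comp.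
rewrite val_eqE.
have -> : (K == [tuple (tnth I (s i)).+1  | i < k]) =
  [forall i, tnth K i == (tnth I (s i)).+1].
  apply/eqP/forallP => [-> i|h]; first by rewrite tnth_mktuple.
  by apply/eq_from_tnth => i; rewrite tnth_mktuple; apply/eqP.
case: forallP => [h|/forallP/forallPn [i hi]].
  by rewrite big1 // => i _; rewrite mxE (h i).
by rewrite (bigD1 i) //= mxE (negPf hi) mul0r.
Qed.

Lemma phi0E i j k : phi0 R [tuple i; j; k] = zR (phiZ i j k).
Proof.
have /Z.eqb_eq -> := all7P k (all7P j (all7P i phi_tableP)).
rewrite zR_sum /phi_triples !big_cons big_nil !zRM addr0; cbn [fst snd].
rewrite zR1 (_ : zR (-1)%stdZ = -1) // !mul1r !mulN1r !addrA /phi0.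
rewrite (@basic_formE 3 [tuple 1; 2; 3]%N _ [:: 0; 1; 2]%N) //.
rewrite (@basic_formE 3 [tuple 1; 4; 5]%N _ [:: 0; 3; 4]%N) //.
rewrite (@basic_formE 3 [tuple 1; 6; 7]%N _ [:: 0; 5; 6]%N) //.
rewrite (@basic_formE 3 [tuple 2; 4; 6]%N _ [:: 1; 3; 5]%N) //.
rewrite (@basic_formE 3 [tuple 2; 5; 7]%N _ [:: 1; 4; 6]%N) //.
rewrite (@basic_formE 3 [tuple 3; 4; 7]%N _ [:: 2; 3; 6]%N) //.
by rewrite (@basic_formE 3 [tuple 3; 5; 6]%N _ [:: 2; 4; 5]%N).
Qed.

Lemma enum_ordD p q :
  enum 'I_(p + q) = map (@lshift p q) (enum 'I_p) ++ map (@rshift p q) (enum 'I_q).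
Proof.
apply: (inj_map val_inj).
rewrite val_enum_ord map_cat -(map_comp val (@lshift p q)) -(map_comp val (@rshift p q)) iotaD.
congr (_ ++ _); first by rewrite -val_enum_ord.
by rewrite add0n -[X in iota X q]addn0 iotaDl -val_enum_ord -map_comp.
Qed.

(** Forms are read as functions on lists of naturals, so that a wedge becomes a sum which the
    integer model can evaluate. *)
Lemma wedge_signed_sum n p q (t : cotensor R n p) (u : cotensor R n q)
    (tF uF : seq nat -> R) (I : (p + q).-tuple 'I_n) :
  (forall J : p.-tuple 'I_n, t J = tF (map val J)) ->
  (forall J : q.-tuple 'I_n, u J = uF (map val J)) ->
  wedge t u I = (p`! * q`!)%:R^-1 *
    signed_sum (fun x y => x - y) 0 (p + q) (map val I)
      (fun r => tF (take p r) * uF (drop p r)).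
Proof.
move=> tE uE; rewrite /wedge -(sum_permE 0%N) ?size_map ?size_tuple //.
congr (_ * _); apply: eq_bigr => s _; congr (_ * _).
have E : [seq nth 0%N (map val I) (s i) | i <- enum 'I_(p + q)] =
  map val [tuple tnth I (s (lshift q j)) | j < p] ++
  map val [tuple tnth I (s (rshift p j)) | j < q].
  rewrite enum_ordD map_cat -!map_comp; congr (_ ++ _); apply: eq_map => i /=;
    set j := s _; by rewrite (nth_map (tnth I j)) ?size_tuple // [in RHS](tnth_nth (tnth I j)).
by rewrite E tE uE take_size_cat ?drop_size_cat // size_map size_tuple.
Qed.

Lemma phi0_seq (I : 3.-tuple 'I_7) : let l := map val I in
  phi0 R I = zR (phiZ (nth 0 l 0) (nth 0 l 1) (nth 0 l 2))%N.
Proof.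
move=> l; rewrite {}/l; case: I => -[|i [|j [|k []]]] // sI.
rewrite [RHS](_ : _ = zR (phiZ i j k)) // -phi0E; congr (phi0 R _); exact/val_inj.
Qed.

Lemma wedge_suml n p q (c : 'I_n -> R) (t : 'I_n -> cotensor R n p)
    (u : cotensor R n q) I :
  wedge (fun J => \sum_a c a * t a J) u I = \sum_a c a * wedge (t a) u I.
Proof.
rewrite /wedge; under [RHS]eq_bigr => a _ do rewrite mulrCA.
rewrite -mulr_sumr; congr (_ * _).
under [RHS]eq_bigr => a _ do rewrite mulr_sumr.
rewrite exchange_big /=; apply: eq_bigr => s _.
rewrite mulr_suml mulr_sumr; apply: eq_bigr => a _.
by rewrite -mulrA mulrCA.
Qed.

Lemma wedge_sumr n p q (c : 'I_n -> R) (t : 'I_n -> cotensor R n p)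
    (u : cotensor R n q) I :
  wedge u (fun J => \sum_a c a * t a J) I = \sum_a c a * wedge u (t a) I.
Proof.
rewrite /wedge; under [RHS]eq_bigr => a _ do rewrite mulrCA.
rewrite -mulr_sumr; congr (_ * _).
under [RHS]eq_bigr => a _ do rewrite mulr_sumr.
rewrite exchange_big /=; apply: eq_bigr => s _.
rewrite !mulr_sumr; apply: eq_bigr => a _.
have E (x y z w : R) : x * (y * (z * w)) = z * (x * (y * w)) by ring.
exact: E.
Qed.

(** This is the metric equation of phi0 for the Euclidean metric and the standard volume form; its
    7! terms are summed by [metricZ]. *)
Lemma wedge_phi0_basis (a b : 'I_7) :
  wedge (wedge (fun I : 2.-tuple 'I_7 => phi0 R [tuple of a :: I])
               (fun I : 2.-tuple 'I_7 => phi0 R [tuple of b :: I]))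
        (phi0 R) (ord_tuple 7) = 6 * (a == b)%:R.
Proof.
pose pF c (r : seq nat) : R := zR (phiZ c (nth 0 r 0) (nth 0 r 1))%N.
have pE (c : 'I_7) (J : 2.-tuple 'I_7) : phi0 R [tuple of c :: J] = pF c (map val J).
  by rewrite phi0_seq.
pose qF (r : seq nat) : R := (2`! * 2`!)%:R^-1 *
  signed_sum (fun x y => x - y) 0 (2 + 2) r
    (fun r => pF a (take 2 r) * pF b (drop 2 r)).
pose rF (r : seq nat) : R := zR (phiZ (nth 0 r 0) (nth 0 r 1) (nth 0 r 2))%N.
rewrite (@wedge_signed_sum 7 4 3 _ _ qF rF); last 2 first.
- by move=> J; apply: (@wedge_signed_sum 7 2 2) => L; apply: pE.
- exact: phi0_seq.
rewrite [X in signed_sum _ _ _ X](_ : _ = iota 0 7); last first.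
  by rewrite /= val_enum_ord.
(* The normalisation of the inner wedge is absorbed into the morphism, so that the sum taken in [Z]
   stays integral. *)
rewrite -(@signed_sum_morph _ _ _ (fun z => (2`! * 2`!)%:R^-1 * zR z) Z.sub Z0 _ _ 7 (iota 0 7)
  (metric_summandZ a b)).
- rewrite metricZE.
  rewrite !zRM zR_delta (natrM _ (4`!)%N (3`!)%N) (natrM _ (2`!)%N (2`!)%N).
  have key (x y z d : R) : x != 0 -> y != 0 -> z != 0 ->
      (x * y)^-1 * ((z * z)^-1 * (y * (x * y * (z * z)) * d)) = y * d.
    by move=> x0 y0 z0; field; rewrite x0 y0 z0.
  have -> : zR 24%stdZ = (4`!)%N%:R by [].
  have -> : zR 6%stdZ = (3`!)%N%:R by [].
  have -> : zR 2%stdZ = (2`!)%N%:R by [].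
  rewrite [RHS](_ : _ = (3`!)%N%:R * (a == b)%:R) //.
  by apply: key; rewrite pnatr_eq0 -lt0n fact_gt0.
- by move=> x y; rewrite zRB mulrBr.
- by rewrite zR0 mulr0.
move=> l; rewrite /metric_summandZ /rF; set c := phiZ _ _ _.
case E : (Z.eqb c _); first by move/Z.eqb_eq: E => ->; rewrite zR0 !mulr0.
rewrite zRM mulrA; congr (_ * _ * _).
apply: (signed_sum_morph (f := zR)) => //; first exact: zRB.
by move=> r; rewrite zRM.
Qed.

Lemma wedge_phi0 (u v : 'rV[R]_7) :
  wedge (wedge (contract u (phi0 R)) (contract v (phi0 R))) (phi0 R) (ord_tuple 7) =
  6 * (u *m v^T) 0 0.
Proof.
have -> : wedge (contract u (phi0 R)) (contract v (phi0 R)) = fun J => \sum_a u 0 a *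
    wedge (fun I : 2.-tuple 'I_7 => phi0 R [tuple of a :: I]) (contract v (phi0 R)) J.
  by apply/funext => J; rewrite /contract wedge_suml.
rewrite wedge_suml !mxE mulr_sumr; apply: eq_bigr => a _.
have -> : wedge (fun I : 2.-tuple 'I_7 => phi0 R [tuple of a :: I])
    (contract v (phi0 R)) = fun J => \sum_b v 0 b *
    wedge (fun I : 2.-tuple 'I_7 => phi0 R [tuple of a :: I])
          (fun I : 2.-tuple 'I_7 => phi0 R [tuple of b :: I]) J.
  by apply/funext => J; rewrite /contract wedge_sumr.
rewrite wedge_suml (bigD1 a) //= big1 => [|b /negPf nb].
  by rewrite wedge_phi0_basis eqxx !mxE /= mulr1 addr0; ring.
by rewrite wedge_phi0_basis eq_sym nb !mulr0.
Qed.

End RealModel.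

(** * Adapted frames from the metric equation *)

Section NormalForm.
Variable R : realType.
Local Notation tensor := (cotensor R 7).
Implicit Types (phi : tensor 3) (g : tensor 2) (vol : tensor 7).

Lemma bilinear_delta n (B : 'M[R]_n) i j :
  ((delta_mx 0 i : 'rV_n) *m B *m (delta_mx 0 j : 'rV_n)^T) 0 0 = B i j.
Proof. by rewrite trmx_delta -rowE -colE !mxE. Qed.

Definition euclidean : tensor 2 := fun I => (tnth I ord0 == tnth I ord_max)%:R.

Lemma euclideanE i j : euclidean [tuple i; j] = (i == j)%:R.
Proof. by []. Qed.

Lemma gram_euclidean : gram euclidean = 1%:M.
Proof. by apply/matrixP => i j; rewrite !mxE. Qed.

(** Row i of A is the i-th coordinate vector written in an adapted frame, so v |-> v *m A carries
    the given structure to phi0 with the Euclidean metric. *)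
Definition adapted_frame phi g vol (A : 'M[R]_7) : Prop :=
  [/\ A \in unitmx, phi = pullback A (phi0 R), gram g = A *m A^T &
      vol = pullback A (@levi_civita R 7)].

Definition G2_triple phi g vol : Prop := exists A, adapted_frame phi g vol A.

(** With w the value of vol on the coordinate frame, the metric equation says w g = det(A) A A^T;
    the condition w^2 = det g then removes the freedom of scale. *)
Lemma G2_tripleP phi g vol :
  positive_form phi -> inner_product g -> unit_volume g vol ->
  metric_equation phi g vol -> G2_triple phi g vol.
Proof.
case=> A uA Ephi [symg posg] [altv volg] meq; exists A.
set w := vol (ord_tuple 7) in volg.
have levi1 : levi_civita R (ord_tuple 7) = 1.
  rewrite /levi_civita (_ : \matrix_(i, j) _ = 1%:M) ?det1 //.
  by apply/matrixP => i j; rewrite !mxE tnth_ord_tuple.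
have E u v : inner g u v * w = \det A * ((u *m A) *m (v *m A)^T) 0 0.
  rewrite meq Ephi !contract_pullback !pullback_wedge.
  set W := wedge _ _.
  have altW : @alternating R 7 7 W by exact: (@wedge_alternating R 7 4 3).
  have W1 : W (ord_tuple 7) = 6 * ((u *m A) *m (v *m A)^T) 0 0 by exact: wedge_phi0.
  have -> : W = fun I => 6 * ((u *m A) *m (v *m A)^T) 0 0 * levi_civita R I.
    apply/funext => I; rewrite (alternating_top _ altW); congr (_ * _); exact: W1.
  rewrite pullbackZ pullback_levi_civita levi1 mulr1.
  by rewrite [in RHS]mulrC !mulrA mulVf ?mul1r // pnatr_eq0.
have Eg : w *: gram g = \det A *: (A *m A^T).
  apply/matrixP => i j; have := E (delta_mx 0 i) (delta_mx 0 j).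
  rewrite /inner bilinear_delta (_ : _ *m (_ *m A)^T = delta_mx 0 i *m (A *m A^T) *m
    (delta_mx 0 j)^T) ?bilinear_delta; last by rewrite trmx_mul !mulmxA.
  by move=> h; rewrite [LHS]mxE [RHS]mxE mulrC.
have detA : \det A != 0 by rewrite -unitfE.
have Ew : w = \det A.
  (* Taking determinants in [Eg] gives w^9 = (det A)^9. *)
  have /(congr1 determinant) := Eg; rewrite !detZ det_mulmx det_tr -volg -!exprD.
  rewrite -expr2 -exprD => h9.
  have r9 : (w / \det A) ^+ 9 = 1 by rewrite expr_div_n h9 divff // expf_neq0.
  (* The quotient w / det A is a real ninth root of 1; the odd exponent excludes -1, which fixes the
     orientation. *)
  have : `|w / \det A| == 1 by rewrite -(@pexpr_eq1 _ _ 9) // -normrX r9 normr1.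
  rewrite eqr_norml ler01 andbT => /orP[/eqP r1|/eqP rN1].
    by rewrite -[LHS](divfK detA) r1 mul1r.
  by move/eqP: r9; rewrite rN1 -signr_odd expr1 eq_sym -subr_eq0 opprK -mulr2n pnatr_eq0.
split => //.
  have := Eg; rewrite Ew => /(scalerI detA) //.
apply/funext => I; rewrite (alternating_top _ altv) pullback_levi_civita -/w Ew //.
Qed.

End NormalForm.

(** * Naturality under a change of frame *)

Section Naturality.
Variable R : realType.
Local Notation tensor := (cotensor R 7).
Local Notation euclidean := (euclidean R).
Local Notation epsilon := (@levi_civita R 7).
Implicit Types (phi chi : tensor 3) (g : tensor 2) (vol : tensor 7) (A : 'M[R]_7).

Definition oct_frame A (X : octonion R) : octonion R := (X.1, X.2 *m A).

Lemma inner_frame A g u v : gram g = A *m A^T ->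
  inner g u v = inner euclidean (u *m A) (v *m A).
Proof.
by move=> Eg; apply: inner_pullback; rewrite Eg gram_euclidean mulmx1.
Qed.

Lemma gram_frame_unit A g : A \in unitmx -> gram g = A *m A^T -> gram g \in unitmx.
Proof. by move=> uA ->; rewrite unitmx_mul unitmx_tr uA. Qed.

(** Raising an index with g becomes the identity once everything is expressed in the adapted
    frame. *)
Lemma frame_inverse A g : A \in unitmx -> gram g = A *m A^T ->
  A^T *m invmx (gram g) *m A = 1%:M.
Proof.
move=> uA Eg; rewrite -mulmxA; apply: mulmx1C.
by rewrite -mulmxA -Eg mulVmx // (gram_frame_unit uA).
Qed.

Lemma cross_frame A g chi u v : A \in unitmx -> gram g = A *m A^T ->
  cross g (pullback A chi) u v *m A = cross euclidean chi (u *m A) (v *m A).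
Proof.
move=> uA Eg; rewrite /cross gram_euclidean invmx1 mulmx1 !contract_pullback.
set t := contract (v *m A) _; set r := \row_c t [tuple c].
have -> : \row_c pullback A t [tuple c] = r *m A^T.
  apply/rowP => c; rewrite !mxE pullback_vector; apply: eq_bigr => b _.
  by rewrite !mxE mulrC.
by rewrite -!mulmxA [A^T *m _]mulmxA frame_inverse // mulmx1.
Qed.

Lemma octmul_frame A g chi X Y : A \in unitmx -> gram g = A *m A^T ->
  oct_frame A (octmul g (pullback A chi) X Y) =
  octmul euclidean chi (oct_frame A X) (oct_frame A Y).
Proof.
move=> uA Eg; rewrite /oct_frame /octmul /= (inner_frame _ _ Eg).
by rewrite !mulmxDl !scalemxAl cross_frame.
Qed.

Lemma oct_norm2_frame A g X : gram g = A *m A^T ->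
  oct_norm2 g X = oct_norm2 euclidean (oct_frame A X).
Proof. by move=> Eg; rewrite /oct_norm2 (inner_frame _ _ Eg). Qed.

(** The volume form carries one factor A per slot. On the four free slots these give the pullback;
    on the three contracted ones they meet the g^-1 A of the raised form, and (g^-1 A)^T A = 1. *)
Lemma dual4_frame A g chi : A \in unitmx -> gram g = A *m A^T ->
  dual4 g (pullback A epsilon) (pullback A chi) =
  pullback A (dual4 euclidean epsilon chi).
Proof.
move=> uA Eg; apply/funext => J; rewrite /dual4 /hodge /sharp pullbackZ.
congr (_ * _); rewrite pullback_comp pullback_sum_adjoint.
pose slice (K : 4.-tuple 'I_7) : tensor 3 := fun I => epsilon [tuple of I ++ K].
have -> : (fun I : 3.-tuple 'I_7 => pullback A epsilon [tuple of I ++ J]) =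
    pullback A (fun I => \sum_(K : 4.-tuple 'I_7)
      (\prod_(s < 4) A (tnth J s) (tnth K s)) * slice K I).
  apply/funext => I; rewrite /pullback (@big_tuple_cat _ _ 3 4).
  apply: eq_bigr => L _; rewrite mulr_sumr; apply: eq_bigr => K _.
  rewrite mulrA (@big_split_ord _ _ _ 3 4) /=; congr (_ * _ * _).
    by apply: eq_bigr => s _; rewrite !(@tnth_lshift _ 3 4).
  by apply: eq_bigr => s _; rewrite !(@tnth_rshift _ 3 4).
have Einv : (invmx (gram g) *m A)^T *m A = 1%:M.
  rewrite trmx_mul trmx_inv (_ : (gram g)^T = gram g) ?frame_inverse //.
  by rewrite Eg trmx_mul trmxK.
rewrite pullback_comp Einv pullback1 gram_euclidean invmx1 pullback1.
under eq_bigr => I _ do rewrite mulr_sumr.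
rewrite exchange_big /=; apply: eq_bigr => K _; rewrite mulr_sumr.
by apply: eq_bigr => I _; rewrite mulrCA.
Qed.

Lemma sigma_frame A g chi V : A \in unitmx -> gram g = A *m A^T ->
  sigma g (pullback A epsilon) V (pullback A chi) =
  pullback A (sigma euclidean epsilon (oct_frame A V) chi).
Proof.
move=> uA Eg; apply/funext => I; rewrite /sigma pullbackZ -(oct_norm2_frame V Eg).
congr (_ * _); rewrite dual4_frame // !contract_pullback.
have Ef : gram g = A *m gram euclidean *m A^T by rewrite gram_euclidean mulmx1.
rewrite (flat_pullback V.2 Ef) pullback_wedge (inner_frame _ _ Eg) /=.
rewrite pullbackD pullbackZ; congr (_ + _).
rewrite -[RHS]/(pullback A (fun I => _ * chi I + - (_ * contract (V.2 *m A) _ I)) I).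
rewrite pullbackD pullbackZ; congr (_ + _); rewrite -mulNr -pullbackZ.
by congr (pullback A _ I); apply/funext => K; rewrite mulNr.
Qed.

End Naturality.

(** * Octonions in eight coordinates *)

Section Coordinates.
Variable R : realType.
Local Notation tensor := (cotensor R 7).
Local Notation euclidean := (euclidean R).
Local Notation epsilon := (@levi_civita R 7).
Local Notation phi0 := (phi0 R).

Definition o0 : 'I_7 := @Ordinal 7 0 isT.
Definition o1 : 'I_7 := @Ordinal 7 1 isT.
Definition o2 : 'I_7 := @Ordinal 7 2 isT.
Definition o3 : 'I_7 := @Ordinal 7 3 isT.
Definition o4 : 'I_7 := @Ordinal 7 4 isT.
Definition o5 : 'I_7 := @Ordinal 7 5 isT.
Definition o6 : 'I_7 := @Ordinal 7 6 isT.

Lemma ord7P (P : 'I_7 -> Prop) :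
  P o0 -> P o1 -> P o2 -> P o3 -> P o4 -> P o5 -> P o6 -> forall k, P k.
Proof.
move=> p0 p1 p2 p3 p4 p5 p6 [[|[|[|[|[|[|[|k]]]]]]] //= h];
  by match goal with p : P ?o |- _ => have -> : Ordinal h = o by apply/val_inj end.
Qed.

Lemma sum7 (V : nmodType) (F : 'I_7 -> V) :
  \sum_i F i = F o0 + F o1 + F o2 + F o3 + F o4 + F o5 + F o6.
Proof.
rewrite !big_ord_recl big_ord0 addr0 !addrA.
by do !congr (_ + _); congr F; apply/val_inj.
Qed.

Lemma inner_euclideanE (u v : 'rV[R]_7) :
  inner euclidean u v = u 0 o0 * v 0 o0 + u 0 o1 * v 0 o1 + u 0 o2 * v 0 o2 +
    u 0 o3 * v 0 o3 + u 0 o4 * v 0 o4 + u 0 o5 * v 0 o5 + u 0 o6 * v 0 o6.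
Proof. by rewrite /inner gram_euclidean mulmx1 mxE sum7 !mxE. Qed.

Lemma cross_euclidean chi (u v : 'rV[R]_7) k :
  cross euclidean chi u v 0 k = \sum_j v 0 j * \sum_i u 0 i * chi [tuple i; j; k].
Proof.
rewrite /cross gram_euclidean invmx1 mulmx1 mxE; apply: eq_bigr => j _.
congr (_ * _); apply: eq_bigr => i _; congr (_ * chi _); exact: val_inj.
Qed.

Lemma zRN1 : zR R (-1)%stdZ = -1. Proof. by []. Qed.

Ltac cross_tac := rewrite cross_euclidean !sum7 !phi0E;
  cbn [phiZ nth phi_table o0 o1 o2 o3 o4 o5 o6 nat_of_ord];
  rewrite ?zR0 ?zR1 ?zRN1; ring.

Lemma crossE0 (u v : 'rV[R]_7) : cross euclidean phi0 u v 0 o0 =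
  u 0 o1 * v 0 o2 - u 0 o2 * v 0 o1 + (u 0 o3 * v 0 o4 - u 0 o4 * v 0 o3) +
  (u 0 o5 * v 0 o6 - u 0 o6 * v 0 o5).
Proof. cross_tac. Qed.

Lemma crossE1 (u v : 'rV[R]_7) : cross euclidean phi0 u v 0 o1 =
  u 0 o2 * v 0 o0 - u 0 o0 * v 0 o2 + (u 0 o3 * v 0 o5 - u 0 o5 * v 0 o3) -
  (u 0 o4 * v 0 o6 - u 0 o6 * v 0 o4).
Proof. cross_tac. Qed.

Lemma crossE2 (u v : 'rV[R]_7) : cross euclidean phi0 u v 0 o2 =
  u 0 o0 * v 0 o1 - u 0 o1 * v 0 o0 - (u 0 o3 * v 0 o6 - u 0 o6 * v 0 o3) -
  (u 0 o4 * v 0 o5 - u 0 o5 * v 0 o4).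
Proof. cross_tac. Qed.

Lemma crossE3 (u v : 'rV[R]_7) : cross euclidean phi0 u v 0 o3 =
  u 0 o4 * v 0 o0 - u 0 o0 * v 0 o4 + (u 0 o5 * v 0 o1 - u 0 o1 * v 0 o5) -
  (u 0 o6 * v 0 o2 - u 0 o2 * v 0 o6).
Proof. cross_tac. Qed.

Lemma crossE4 (u v : 'rV[R]_7) : cross euclidean phi0 u v 0 o4 =
  u 0 o0 * v 0 o3 - u 0 o3 * v 0 o0 - (u 0 o6 * v 0 o1 - u 0 o1 * v 0 o6) -
  (u 0 o5 * v 0 o2 - u 0 o2 * v 0 o5).
Proof. cross_tac. Qed.

Lemma crossE5 (u v : 'rV[R]_7) : cross euclidean phi0 u v 0 o5 =
  u 0 o6 * v 0 o0 - u 0 o0 * v 0 o6 + (u 0 o1 * v 0 o3 - u 0 o3 * v 0 o1) -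
  (u 0 o2 * v 0 o4 - u 0 o4 * v 0 o2).
Proof. cross_tac. Qed.

Lemma crossE6 (u v : 'rV[R]_7) : cross euclidean phi0 u v 0 o6 =
  u 0 o0 * v 0 o5 - u 0 o5 * v 0 o0 - (u 0 o1 * v 0 o4 - u 0 o4 * v 0 o1) -
  (u 0 o2 * v 0 o3 - u 0 o3 * v 0 o2).
Proof. cross_tac. Qed.

End Coordinates.

Section CoordinateModel.
Variable R : comPzRingType.
(** A plain record over a commutative ring keeps matrices and tuples out of the polynomial
    identities, so that [ring] sees only the coordinates. *)
Record oct8 := Oct8 { c0 : R; c1 : R; c2 : R; c3 : R; c4 : R; c5 : R; c6 : R; c7 : R }.

Definition dot8 (x y : oct8) : R :=
  c1 x * c1 y + c2 x * c2 y + c3 x * c3 y + c4 x * c4 y + c5 x * c5 y + c6 x * c6 y + c7 x * c7 y.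

Definition comb8 (a : R) x (b : R) y : oct8 :=
  Oct8 (a * c0 x + b * c0 y) (a * c1 x + b * c1 y) (a * c2 x + b * c2 y) (a * c3 x + b * c3 y)
   (a * c4 x + b * c4 y) (a * c5 x + b * c5 y) (a * c6 x + b * c6 y) (a * c7 x + b * c7 y).

Definition cross8 (u v : oct8) : oct8 := Oct8 0
  (c2 u * c3 v - c3 u * c2 v + (c4 u * c5 v - c5 u * c4 v) + (c6 u * c7 v - c7 u * c6 v))
  (c3 u * c1 v - c1 u * c3 v + (c4 u * c6 v - c6 u * c4 v) - (c5 u * c7 v - c7 u * c5 v))
  (c1 u * c2 v - c2 u * c1 v - (c4 u * c7 v - c7 u * c4 v) - (c5 u * c6 v - c6 u * c5 v))
  (c5 u * c1 v - c1 u * c5 v + (c6 u * c2 v - c2 u * c6 v) - (c7 u * c3 v - c3 u * c7 v))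
  (c1 u * c4 v - c4 u * c1 v - (c7 u * c2 v - c2 u * c7 v) - (c6 u * c3 v - c3 u * c6 v))
  (c7 u * c1 v - c1 u * c7 v + (c2 u * c4 v - c4 u * c2 v) - (c3 u * c5 v - c5 u * c3 v))
  (c1 u * c6 v - c6 u * c1 v - (c2 u * c5 v - c5 u * c2 v) - (c3 u * c4 v - c4 u * c3 v)).

Definition mul8 (x y : oct8) : oct8 :=
  let z := cross8 x y in
  Oct8 (c0 x * c0 y - dot8 x y)
   (c0 x * c1 y + c0 y * c1 x + c1 z) (c0 x * c2 y + c0 y * c2 x + c2 z)
   (c0 x * c3 y + c0 y * c3 x + c3 z) (c0 x * c4 y + c0 y * c4 x + c4 z)
   (c0 x * c5 y + c0 y * c5 x + c5 z) (c0 x * c6 y + c0 y * c6 x + c6 z)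
   (c0 x * c7 y + c0 y * c7 x + c7 z).

Definition conj8 x := Oct8 (c0 x) (- c1 x) (- c2 x) (- c3 x) (- c4 x) (- c5 x) (- c6 x) (- c7 x).

Definition norm8 x := c0 x ^+ 2 + dot8 x x.


Lemma oct8P x y : c0 x = c0 y -> c1 x = c1 y -> c2 x = c2 y -> c3 x = c3 y ->
  c4 x = c4 y -> c5 x = c5 y -> c6 x = c6 y -> c7 x = c7 y -> x = y.
Proof.
by case: x y => x0 x1 x2 x3 x4 x5 x6 x7 [y0 y1 y2 y3 y4 y5 y6 y7] /= -> -> -> -> -> -> -> ->.
Qed.

Ltac oct8_ring := apply: oct8P;
  cbv [mul8 conj8 comb8 norm8 dot8 cross8 c0 c1 c2 c3 c4 c5 c6 c7]; ring.

(** An instance of alternativity: the subalgebra generated by x and y is associative and contains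
    the conjugate of y. *)
Lemma mul8K x y : mul8 (mul8 x y) (conj8 y) = comb8 (norm8 y) x 0 x.
Proof.
case: x y => ? ? ? ? ? ? ? ? [? ? ? ? ? ? ? ?].
oct8_ring.
Qed.

Definition real8 a := Oct8 a 0 0 0 0 0 0 0.
Definition imag8 x := Oct8 0 (c1 x) (c2 x) (c3 x) (c4 x) (c5 x) (c6 x) (c7 x).

Definition assoc8 t a b :=
  comb8 1 (comb8 1 (cross8 (cross8 a b) t) (- dot8 a b) (imag8 t))
    (-1) (comb8 1 (cross8 a (cross8 b t)) (- dot8 b t) (imag8 a)).

(** Reals associate with everything, so only the imaginary parts of a and b enter. The real parts of
    the two products cancel because <a x b, t> = <a, b x t>. *)
Lemma mul8_assoc a b t : c0 t = 0 ->
  comb8 1 (mul8 (mul8 a b) t) (-1) (mul8 a (mul8 b t)) = assoc8 t a b.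
Proof.
case: a b t => ? ? ? ? ? ? ? ? [? ? ? ? ? ? ? ?] [? ? ? ? ? ? ? ?] /= ->.
rewrite /assoc8 /imag8; oct8_ring.
Qed.

(** The groups after the one scaled by |v|^2 are the summands of sigma_v(phi0) on x and y, without
    the factor 1/|v|^2: the associator is 2 v _| psi0 on x and y, and the group with coefficient 2
    comes from v /\ (v _| phi0). *)
Lemma mul8_sigma x y v :
  mul8 (mul8 x (mul8 y v)) (conj8 v) =
  comb8 (norm8 v) (comb8 1 (real8 (c0 x * c0 y - dot8 x y))
                         1 (comb8 (c0 x) (imag8 y) (c0 y) (imag8 x)))
  1 (comb8 1 (comb8 (c0 v ^+ 2 - dot8 v v) (cross8 x y) (- c0 v) (assoc8 v x y))
    2 (comb8 1 (comb8 (dot8 v x) (cross8 v y) (- dot8 v y) (cross8 v x))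
             (dot8 (cross8 v x) y) (imag8 v))).
Proof.
case: x y v => ? ? ? ? ? ? ? ? [? ? ? ? ? ? ? ?] [? ? ? ? ? ? ? ?].
rewrite /assoc8 /imag8 /real8; oct8_ring.
Qed.
End CoordinateModel.

(** * Octonion identities for phi0 and its dual *)

Section OctonionIdentities.
Variable R : realType.
Local Notation tensor := (cotensor R 7).
Local Notation euclidean := (euclidean R).
Local Notation epsilon := (@levi_civita R 7).
Local Notation phi0 := (phi0 R).
Local Notation psi0 := (dual4 euclidean epsilon phi0).
Local Notation mul0 := (octmul euclidean phi0).

Definition oct_conj (X : octonion R) : octonion R := (X.1, - X.2).

Lemma oct_eqP (X Y : octonion R) : X.1 = Y.1 -> (forall k, X.2 0 k = Y.2 0 k) -> X = Y.
Proof.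
by case: X Y => [x u] [y v] /= -> h; congr pair; apply/rowP.
Qed.

Lemma oct_scale1 c (X : octonion R) : (c *: X).1 = c * X.1. Proof. by []. Qed.
Lemma oct_scale2 c (X : octonion R) : (c *: X).2 = c *: X.2. Proof. by []. Qed.
Lemma oct_add1 (X Y : octonion R) : (X + Y).1 = X.1 + Y.1. Proof. by []. Qed.
Lemma oct_add2 (X Y : octonion R) : (X + Y).2 = X.2 + Y.2. Proof. by []. Qed.
Lemma oct_opp1 (X : octonion R) : (- X).1 = - X.1. Proof. by []. Qed.
Lemma oct_opp2 (X : octonion R) : (- X).2 = - X.2. Proof. by []. Qed.

Definition oct_compE := (oct_scale1, oct_scale2, oct_add1, oct_add2, oct_opp1, oct_opp2).

Definition coord8 (X : octonion R) : oct8 R :=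
  Oct8 X.1 (X.2 0 o0) (X.2 0 o1) (X.2 0 o2) (X.2 0 o3) (X.2 0 o4) (X.2 0 o5) (X.2 0 o6).

Lemma coord8_inj : injective coord8.
Proof.
move=> [x u] [y v] /= []; rewrite /coord8 /= => -> h0 h1 h2 h3 h4 h5 h6.
by congr pair; apply/rowP; apply: ord7P.
Qed.

Lemma coord8_comb a b (X Y : octonion R) :
  coord8 (a *: X + b *: Y) = comb8 a (coord8 X) b (coord8 Y).
Proof. by rewrite /coord8 /comb8 !oct_compE !mxE. Qed.

Lemma coord8_conj (X : octonion R) : coord8 (oct_conj X) = conj8 (coord8 X).
Proof. by rewrite /coord8 /conj8 /oct_conj /= !mxE. Qed.

Lemma coord8_dot (X Y : octonion R) :
  dot8 (coord8 X) (coord8 Y) = inner euclidean X.2 Y.2.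
Proof. by rewrite inner_euclideanE. Qed.

Lemma coord8_norm (X : octonion R) : norm8 (coord8 X) = oct_norm2 euclidean X.
Proof. by rewrite /norm8 coord8_dot. Qed.

Lemma coord8_cross (X Y : octonion R) :
  coord8 (0, cross euclidean phi0 X.2 Y.2) = cross8 (coord8 X) (coord8 Y).
Proof.
by rewrite /coord8 /cross8 /= crossE0 crossE1 crossE2 crossE3 crossE4 crossE5 crossE6.
Qed.

Lemma coord8_mul (X Y : octonion R) :
  coord8 (mul0 X Y) = mul8 (coord8 X) (coord8 Y).
Proof.
by rewrite /mul8 coord8_dot -coord8_cross /coord8 /octmul /= !mxE.
Qed.

Lemma coord8_imag (X : octonion R) : imag8 (coord8 X) = coord8 (0, X.2).
Proof. by []. Qed.

Lemma coord8_real (x : R) : real8 x = coord8 (x, 0).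
Proof. by rewrite /coord8 /real8 /= !mxE. Qed.

Lemma octmulK0 (X Y : octonion R) :
  mul0 (mul0 X Y) (oct_conj Y) = oct_norm2 euclidean Y *: X.
Proof.
rewrite -[RHS]addr0 -[X in _ + X](scale0r X); apply: coord8_inj.
by rewrite coord8_comb !coord8_mul coord8_conj mul8K coord8_norm.
Qed.

Definition assoc_vector (t a b : 'rV[R]_7) : 'rV[R]_7 :=
  (cross euclidean phi0 (cross euclidean phi0 a b) t - inner euclidean a b *: t) -
  (cross euclidean phi0 a (cross euclidean phi0 b t) - inner euclidean b t *: a).

Lemma coord8_assoc (T A B : octonion R) :
  coord8 (0, assoc_vector T.2 A.2 B.2) = assoc8 (coord8 T) (coord8 A) (coord8 B).
Proof.
rewrite /assoc8 -!coord8_cross !coord8_dot !coord8_imag.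
rewrite -!coord8_comb /=; congr coord8.
by apply: oct_eqP => [|k]; rewrite ?oct_compE /= /assoc_vector ?mxE; ring.
Qed.

Lemma octmul_assoc0 (A B : octonion R) (t : 'rV[R]_7) :
  mul0 (mul0 A B) (0, t) - mul0 A (mul0 B (0, t)) = (0, assoc_vector t A.2 B.2).
Proof.
rewrite -[mul0 (mul0 _ _) _]scale1r -scaleN1r; apply: coord8_inj.
by rewrite coord8_comb !coord8_mul mul8_assoc // -coord8_assoc.
Qed.

Lemma octmul_sigma0 (X Y V : octonion R) : let v := V.2 in
  mul0 (mul0 X (mul0 Y V)) (oct_conj V) =
  oct_norm2 euclidean V *: (X.1 * Y.1 - inner euclidean X.2 Y.2,
                            X.1 *: Y.2 + Y.1 *: X.2) +
  (0, (V.1 ^+ 2 - inner euclidean v v) *: cross euclidean phi0 X.2 Y.2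
      - V.1 *: assoc_vector v X.2 Y.2
      + 2 *: (inner euclidean v X.2 *: cross euclidean phi0 v Y.2
              - inner euclidean v Y.2 *: cross euclidean phi0 v X.2
              + inner euclidean (cross euclidean phi0 v X.2) Y.2 *: v)).
Proof.
move=> v; apply: coord8_inj; rewrite !coord8_mul coord8_conj mul8_sigma.
rewrite coord8_norm -coord8_assoc -!coord8_cross !coord8_dot !coord8_imag !coord8_real.
rewrite -[inner _ (cross _ _ _ _) _](coord8_dot (0, _) _) coord8_dot /=.
rewrite -!coord8_comb; congr coord8.
by apply: oct_eqP => [|k]; rewrite ?oct_compE /= ?mxE; ring.
Qed.

(** The slot order is that of T_X _| psi. When psi is the dual of the G2-form, twice this vector is
    the associator (xy)t - x(yt). *)
Definition associator4 (g : tensor 2) (psi : tensor 4) (t x y : 'rV[R]_7) : 'rV[R]_7 :=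
  (\row_d contract y (contract x (contract t psi)) [tuple d]) *m invmx (gram g).

Lemma sum_phi_terms (f : nat -> nat -> nat -> Z) :
  \sum_(a < 7) \sum_(b < 7) \sum_(c < 7) zR R (Z.mul (phiZ a b c) (f a b c)) =
  \sum_(p <- phi_terms) zR R (Z.mul (phiZ p.1.1 p.1.2 p.2) (f p.1.1 p.1.2 p.2)).
Proof.
have sumE (F : nat -> R) : \sum_(a < 7) F a = \sum_(a <- iota 0 7) F a.
  by rewrite -(big_mkord xpredT F).
have -> : phi_terms = [seq p <- [seq (p, k) | p <- [seq (i, j) | i <- iota 0 7,
    j <- iota 0 7], k <- iota 0 7] | ~~ Z.eqb (phiZ p.1.1 p.1.2 p.2) Z0]%N.
  by vm_compute.
rewrite big_filter [RHS]big_mkcond [RHS]big_allpairs [RHS]big_allpairs -sumE.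
apply: eq_bigr => a _; rewrite -sumE; apply: eq_bigr => b _; rewrite -sumE.
apply: eq_bigr => c _; cbn [fst snd].
by case E : (Z.eqb _ _) => //; move/Z.eqb_eq: E => ->; rewrite zRM mul0r.
Qed.

(** The constant 1/2 is 3/3!: the 3 comes from [hodgeZE], the 3! from the Hodge star. *)
Lemma psi0E (i j k l : 'I_7) :
  psi0 [tuple i; j; k; l] = 2^-1 * zR R (associatorZ i j k l).
Proof.
rewrite /dual4 /hodge /sharp gram_euclidean invmx1 pullback1.
pose f a b c := epsilonZ (iota 0 7) [:: a; b; c; val i; val j; val k; val l].
have -> : \sum_(I : 3.-tuple 'I_7) phi0 I * epsilon [tuple of I ++ [tuple i; j; k; l]]
    = zR R (hodgeZ i j k l).
  rewrite /hodgeZ zR_sum -(sum_phi_terms f) big_tuple_cons; apply: eq_bigr => a _.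
  rewrite big_tuple_cons; apply: eq_bigr => b _.
  rewrite big_tuple_cons; apply: eq_bigr => c _.
  by rewrite big_tuple0 zRM -phi0E levi_civitaE.
rewrite hodgeZE zRM mulrA; congr (_ * _).
have -> : zR R 3%stdZ = 3 by [].
by rewrite !factS fact0 !natrM; field.
Qed.

End OctonionIdentities.

(** * The octonion product of sigma_V(phi0) *)

Section SigmaEuclidean.
Variable R : realType.
Local Notation tensor := (cotensor R 7).
Local Notation euclidean := (euclidean R).
Local Notation epsilon := (@levi_civita R 7).
Local Notation phi0 := (phi0 R).
Local Notation psi0 := (dual4 euclidean epsilon phi0).
Local Notation mul0 := (octmul euclidean phi0).
Local Notation cross0 := (cross euclidean phi0).

Lemma phiZ_antisym : all7 (fun i => all7 (fun j => all7 (fun k =>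
  Z.eqb (phiZ i k j) (- phiZ i j k)%stdZ))).
Proof. by vm_compute. Qed.

Lemma associator4_euclidean (psi : tensor 4) (t x y : 'rV[R]_7) k :
  associator4 euclidean psi t x y 0 k =
  \sum_j y 0 j * \sum_i x 0 i * \sum_l t 0 l * psi [tuple l; i; j; k].
Proof.
rewrite /associator4 gram_euclidean invmx1 mulmx1 mxE.
apply: eq_bigr => j _; congr (_ * _); by apply: eq_bigr => i _; congr (_ * _).
Qed.

Lemma sum_deltar (F : 'I_7 -> R) j : \sum_i F i * (i == j)%:R = F j.
Proof.
rewrite (bigD1 j) //= eqxx mulr1 big1 ?addr0 // => i /negPf ->.
by rewrite mulr0.
Qed.

Lemma inner_euclidean_sum (u v : 'rV[R]_7) :
  inner euclidean u v = \sum_i u 0 i * v 0 i.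
Proof.
by rewrite /inner gram_euclidean mulmx1 mxE; apply: eq_bigr => i _; rewrite mxE.
Qed.

(** Both sides are trilinear in t, x and y, and [S F] is the trilinear form with coefficient array
    F; the arrays agree by [psi0E]. *)
Lemma associator4_psi0 (t x y : 'rV[R]_7) :
  2 *: associator4 euclidean psi0 t x y = assoc_vector t x y.
Proof.
apply/rowP => k; rewrite mxE associator4_euclidean.
pose S (F : 'I_7 -> 'I_7 -> 'I_7 -> R) :=
  \sum_j \sum_i \sum_l y 0 j * x 0 i * t 0 l * F l i j.
have SE F : \sum_j y 0 j * \sum_i x 0 i * \sum_l t 0 l * F l i j = S F.
  apply: eq_bigr => j _; rewrite mulr_sumr; apply: eq_bigr => i _.
  by rewrite !mulr_sumr; apply: eq_bigr => l _; rewrite !mulrA.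
have SB F G : S F - S G = S (fun l i j => F l i j - G l i j).
  rewrite /S -sumrB; apply: eq_bigr => j _; rewrite -sumrB.
  apply: eq_bigr => i _; rewrite -sumrB; apply: eq_bigr => l _.
  by rewrite mulrBr.
have SZ c F : c * S F = S (fun l i j => c * F l i j).
  rewrite /S mulr_sumr; apply: eq_bigr => j _; rewrite mulr_sumr.
  apply: eq_bigr => i _; rewrite mulr_sumr; apply: eq_bigr => l _.
  by rewrite mulrCA.
rewrite SE SZ.
have S1 : cross0 (cross0 x y) t 0 k =
    S (fun l i j => \sum_e phi0 [tuple i; j; e] * phi0 [tuple e; l; k]).
  rewrite cross_euclidean /S.
  under [RHS]eq_bigr => j _ do rewrite exchange_big /=.
  rewrite [RHS]exchange_big /=; apply: eq_bigr => l _.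
  under eq_bigr => e _ do rewrite cross_euclidean mulr_suml.
  rewrite exchange_big /= mulr_sumr; apply: eq_bigr => j _.
  under eq_bigr => e _ do rewrite mulr_sumr mulr_suml.
  rewrite exchange_big /= mulr_sumr; apply: eq_bigr => i _.
  by rewrite !mulr_sumr; apply: eq_bigr => e _; ring.
have S2 : inner euclidean x y * t 0 k = S (fun l i j => (i == j)%:R * (l == k)%:R).
  rewrite inner_euclidean_sum mulr_suml; apply: eq_bigr => j _.
  rewrite -(sum_deltar (fun i => x 0 i * y 0 j * t 0 k)); apply: eq_bigr => i _.
  rewrite -(sum_deltar (fun l => x 0 i * y 0 j * t 0 l * (i == j)%:R) k).
  by apply: eq_bigr => l _; ring.
have S3 : cross0 x (cross0 y t) 0 k =
    S (fun l i j => \sum_e phi0 [tuple j; l; e] * phi0 [tuple i; e; k]).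
  transitivity (\sum_e \sum_j \sum_l y 0 j * t 0 l * phi0 [tuple j; l; e] *
      \sum_i x 0 i * phi0 [tuple i; e; k]).
    rewrite cross_euclidean; apply: eq_bigr => e _.
    move: (\sum_i x 0 i * phi0 [tuple i; e; k]) => Q.
    rewrite cross_euclidean mulr_suml [RHS]exchange_big; apply: eq_bigr => l _.
    by rewrite mulr_sumr mulr_suml; apply: eq_bigr => j _; ring.
  rewrite exchange_big /=; apply: eq_bigr => j _.
  rewrite exchange_big [RHS]exchange_big /=; apply: eq_bigr => l _.
  under [RHS]eq_bigr => i _ do rewrite mulr_sumr.
  rewrite [RHS]exchange_big /=; apply: eq_bigr => e _.
  by rewrite mulr_sumr; apply: eq_bigr => i _; ring.
have S4 : inner euclidean y t * x 0 k = S (fun l i j => (j == l)%:R * (i == k)%:R).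
  rewrite inner_euclidean_sum mulr_suml; apply: eq_bigr => j _.
  rewrite exchange_big /=.
  rewrite -(sum_deltar (fun l => y 0 j * t 0 l * x 0 k)); apply: eq_bigr => l _.
  rewrite -(sum_deltar (fun i => y 0 j * t 0 l * x 0 i)) mulr_suml.
  by apply: eq_bigr => i _; rewrite [l == j]eq_sym; ring.
rewrite /assoc_vector; move: S1 S3.
move: (cross0 (cross0 x y) t) (cross0 x (cross0 y t)) => a b S1 S3.
rewrite !mxE S1 S3 S2 S4 !SB; congr S; do 3 apply/funext => ?.
rewrite psi0E mulrA divff ?pnatr_eq0 // mul1r /associatorZ !(zRB, zRM, zR_delta) !zR_sum.
have sumE (F : nat -> R) : \sum_(a <- iota 0 7) F a = \sum_(a < 7) F a.
  by rewrite -(big_mkord xpredT F).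
rewrite !sumE; congr (_ - _ - (_ - _)); apply: eq_bigr => e _; by rewrite zRM -!phi0E.
Qed.

(** Of the six orderings, those that differ by a swap inside the 2-form contribute equally, which
    cancels the factor 1/(1! 2!). *)
Lemma wedge_flat_contract (v : 'rV[R]_7) (i j k : 'I_7) :
  wedge (flat euclidean v) (contract v phi0) [tuple i; j; k] =
  v 0 i * contract v phi0 [tuple j; k] - v 0 j * contract v phi0 [tuple i; k]
  + v 0 k * contract v phi0 [tuple i; j].
Proof.
have flatE (l : 'I_7) : flat euclidean v [tuple l] = v 0 l.
  rewrite /flat -[RHS](sum_deltar (fun m => v 0 m)); apply: eq_bigr => m _.
  by rewrite euclideanE mulrC eq_sym.
(* The default of [inord] is never met, since only indices below 7 occur. *)
pose tF (l : seq nat) : R := v 0 (inord (nth 0 l 0)%N).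
pose uF (l : seq nat) : R := \sum_a v 0 a * zR R (phiZ a (nth 0 l 0) (nth 0 l 1))%N.
have uE (J : 2.-tuple 'I_7) : contract v phi0 J = uF (map val J).
  by apply: eq_bigr => a _; rewrite phi0_seq.
rewrite (@wedge_signed_sum R 7 1 2 _ _ tF uF) //; last first.
  case=> -[|l []] // sl; rewrite /tF /= inord_val -flatE; congr flat; exact: val_inj.
have uA (a b : 'I_7) : contract v phi0 [tuple b; a] = - contract v phi0 [tuple a; b].
  rewrite !uE /uF -sumrN; apply: eq_bigr => c _ /=.
  have /Z.eqb_eq -> := all7P b (all7P a (all7P c phiZ_antisym)).
  by rewrite /zR (rmorphN int_of_Z) rmorphN mulrN.
have uE' (a b : 'I_7) : uF [:: val a; val b] = contract v phi0 [tuple a; b].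
  by rewrite uE.
rewrite /= /tF /= !inord_val !uE' (uA j i) (uA k i) (uA k j).
by rewrite (_ : (1`! * 2`!)%:R = 2) //; field.
Qed.

(** The bracket is the one in [octmul_sigma0]; this agreement is what makes the formula for sigma
    describe the product (x(yV)) times the conjugate of V. *)
Lemma cross_sigma0 (V : octonion R) (x y : 'rV[R]_7) : let v := V.2 in
  cross euclidean (sigma euclidean epsilon V phi0) x y =
  (oct_norm2 euclidean V)^-1 *:
   ((V.1 ^+ 2 - inner euclidean v v) *: cross0 x y - V.1 *: assoc_vector v x y
      + 2 *: (inner euclidean v x *: cross0 v y - inner euclidean v y *: cross0 v x
              + inner euclidean (cross0 v x) y *: v)).
Proof.
move=> v; apply/rowP => k; rewrite [RHS]mxE cross_euclidean.
pose c := V.1 ^+ 2 - inner euclidean v v.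
pose w (i j : 'I_7) := contract v phi0 [tuple i; j].
pose psi (i j : 'I_7) := contract v psi0 [tuple i; j; k].
have E i j : sigma euclidean epsilon V phi0 [tuple i; j; k] =
  (oct_norm2 euclidean V)^-1 * (c * phi0 [tuple i; j; k] - V.1 * (2 * psi i j)
   + 2 * (v 0 i * w j k - v 0 j * w i k + v 0 k * w i j)).
  by rewrite /sigma wedge_flat_contract; congr (_ * (_ - _ + _)); rewrite -mulrA mulrCA.
(* [B] pairs a coefficient array with x and y; by its linearity each term of sigma is treated
   alone. *)
pose B (F : 'I_7 -> 'I_7 -> R) := \sum_j y 0 j * \sum_i x 0 i * F i j.
have BD F G : B (fun i j => F i j + G i j) = B F + B G.
  rewrite /B -big_split; apply: eq_bigr => j _; rewrite /= -mulrDr -big_split /=.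
  by congr (_ * _); apply: eq_bigr => i _; rewrite mulrDr.
have BZ a F : B (fun i j => a * F i j) = a * B F.
  rewrite /B mulr_sumr; apply: eq_bigr => j _; rewrite mulrCA; congr (_ * _).
  by rewrite mulr_sumr; apply: eq_bigr => i _; rewrite mulrCA.
have BN F : B (fun i j => - F i j) = - B F.
  by rewrite -[RHS]mulN1r -BZ; congr B; do 2 apply/funext => ?; rewrite mulN1r.
have wE (z : 'rV[R]_7) j : cross0 v z 0 j = \sum_i z 0 i * w i j.
  by rewrite cross_euclidean; apply: eq_bigr => i _; congr (_ * _).
have B1 : B (fun i j => phi0 [tuple i; j; k]) = cross0 x y 0 k by rewrite cross_euclidean.
have B2 : B (fun i j => 2 * psi i j) = assoc_vector v x y 0 k.
  by rewrite BZ -associator4_psi0 mxE associator4_euclidean.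
have B3 : B (fun i j => v 0 i * w j k) = inner euclidean v x * cross0 v y 0 k.
  rewrite wE inner_euclidean_sum mulr_sumr; apply: eq_bigr => j _; rewrite mulrCA; congr (_ * _).
  by rewrite mulr_suml; apply: eq_bigr => i _; ring.
have B4 : B (fun i j => v 0 j * w i k) = inner euclidean v y * cross0 v x 0 k.
  rewrite wE inner_euclidean_sum mulr_suml; apply: eq_bigr => j _.
  rewrite mulr_sumr mulr_sumr; apply: eq_bigr => i _; ring.
have B5 : B (fun i j => v 0 k * w i j) = inner euclidean (cross0 v x) y * v 0 k.
  rewrite BZ mulrC inner_euclidean_sum; congr (_ * _); apply: eq_bigr => j _.
  by rewrite wE mulrC.
transitivity (B (fun i j => sigma euclidean epsilon V phi0 [tuple i; j; k])) => //.
rewrite (_ : (fun i j => _) = (fun i j => (oct_norm2 euclidean V)^-1 *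
  (c * phi0 [tuple i; j; k] + - (V.1 * (2 * psi i j))
   + 2 * (v 0 i * w j k + - (v 0 j * w i k) + v 0 k * w i j)))); last first.
  by do 2 apply/funext => ?; rewrite E.
pose f1 i j := phi0 [tuple i; j; k]; pose f2 i j := 2 * psi i j.
pose f3 (i j : 'I_7) := v 0 i * w j k; pose f4 (i j : 'I_7) := v 0 j * w i k.
pose f5 (i j : 'I_7) := v 0 k * w i j.
pose g1 i j := c * f1 i j; pose g2 i j := - (V.1 * f2 i j).
pose g3 i j := 2 * (f3 i j - f4 i j + f5 i j).
rewrite (BZ _ (fun i j => g1 i j + g2 i j + g3 i j)) (BD (fun i j => g1 i j + g2 i j) g3).
rewrite (BD g1 g2) (BZ c f1) (BN (fun i j => V.1 * f2 i j)) (BZ V.1 f2).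
rewrite (BZ 2 (fun i j => f3 i j - f4 i j + f5 i j)) (BD (fun i j => f3 i j - f4 i j) f5).
by rewrite (BD f3 (fun i j => - f4 i j)) (BN f4) B1 B2 B3 B4 B5 !mxE.
Qed.

Lemma octmul_sigma_euclidean (X Y V : octonion R) :
  oct_norm2 euclidean V != 0 ->
  mul0 (mul0 X (mul0 Y V)) (oct_conj V) = oct_norm2 euclidean V *:
    octmul euclidean (sigma euclidean epsilon V phi0) X Y.
Proof.
move=> nV; rewrite octmul_sigma0.
apply: oct_eqP => [|k]; rewrite !oct_compE /= ?addr0 //.
by rewrite cross_sigma0 [in RHS]scalerDr scalerA divff // scale1r.
Qed.

End SigmaEuclidean.

(** * Bilinearity of the octonion product *)

Section Bilinearity.
Variable R : realType.
Local Notation tensor := (cotensor R 7).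
Implicit Types (phi chi : tensor 3) (g : tensor 2) (vol : tensor 7).

Lemma inner_linearl g c (u u' v : 'rV[R]_7) :
  inner g (c *: u + u') v = c * inner g u v + inner g u' v.
Proof. by rewrite /inner !mulmxDl -!scalemxAl !mxE. Qed.

Lemma inner_linearr g c (u v v' : 'rV[R]_7) :
  inner g u (c *: v + v') = c * inner g u v + inner g u v'.
Proof. by rewrite /inner linearP mulmxDr -scalemxAr !mxE. Qed.

Lemma inner0l g (v : 'rV[R]_7) : inner g 0 v = 0.
Proof. by rewrite /inner !mul0mx mxE. Qed.

Lemma inner0r g (v : 'rV[R]_7) : inner g v 0 = 0.
Proof. by rewrite /inner linear0 mulmx0 mxE. Qed.

Lemma innerZl g c (u v : 'rV[R]_7) : inner g (c *: u) v = c * inner g u v.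
Proof. by rewrite -[c *: u]addr0 inner_linearl inner0l addr0. Qed.

Lemma innerZr g c (u v : 'rV[R]_7) : inner g u (c *: v) = c * inner g u v.
Proof. by rewrite -[c *: v]addr0 inner_linearr inner0r addr0. Qed.

Definition basis_cross g chi (i j : 'I_7) : 'rV[R]_7 :=
  (\row_c chi [tuple i; j; c]) *m invmx (gram g).

Lemma cross_sum g chi (u v : 'rV[R]_7) :
  cross g chi u v = \sum_j \sum_i (v 0 j * u 0 i) *: basis_cross g chi i j.
Proof.
rewrite /cross /basis_cross; under [RHS]eq_bigr => j _.
  under eq_bigr => i _ do rewrite scalemxAl.
  rewrite -mulmx_suml; over.
rewrite -mulmx_suml; congr (_ *m _); apply/rowP => c.
rewrite !mxE summxE; apply: eq_bigr => j _; rewrite summxE mulr_sumr.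
by apply: eq_bigr => i _; rewrite !mxE mulrA.
Qed.

Lemma cross_linearl g chi c (u u' v : 'rV[R]_7) :
  cross g chi (c *: u + u') v = c *: cross g chi u v + cross g chi u' v.
Proof.
rewrite !cross_sum scaler_sumr -big_split; apply: eq_bigr => j _ /=.
rewrite scaler_sumr -big_split; apply: eq_bigr => i _ /=.
by rewrite scalerA -scalerDl !mxE; congr (_ *: _); ring.
Qed.

Lemma cross_linearr g chi c (u v v' : 'rV[R]_7) :
  cross g chi u (c *: v + v') = c *: cross g chi u v + cross g chi u v'.
Proof.
rewrite !cross_sum scaler_sumr -big_split; apply: eq_bigr => j _ /=.
rewrite scaler_sumr -big_split; apply: eq_bigr => i _ /=.
by rewrite scalerA -scalerDl !mxE; congr (_ *: _); ring.
Qed.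

Lemma octmul_linearl g chi c (X X' Y : octonion R) :
  octmul g chi (c *: X + X') Y = c *: octmul g chi X Y + octmul g chi X' Y.
Proof.
apply: oct_eqP => [|k]; rewrite ?oct_compE /octmul /= ?oct_compE ?inner_linearl ?cross_linearl
  -[c *: X.1]/(c * X.1).
  ring.
move: (cross _ _ _ _) (cross _ _ _ _) => a b; rewrite !mxE; ring.
Qed.

Lemma octmul_linearr g chi c (X Y Y' : octonion R) :
  octmul g chi X (c *: Y + Y') = c *: octmul g chi X Y + octmul g chi X Y'.
Proof.
apply: oct_eqP => [|k]; rewrite ?oct_compE /octmul /= ?oct_compE ?inner_linearr ?cross_linearr
  -[c *: Y.1]/(c * Y.1).
  ring.
move: (cross _ _ _ _) (cross _ _ _ _) => a b; rewrite !mxE; ring.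
Qed.

Lemma octmulDl g chi (X X' Y : octonion R) :
  octmul g chi (X + X') Y = octmul g chi X Y + octmul g chi X' Y.
Proof. by rewrite -[X in X + X']scale1r octmul_linearl scale1r. Qed.

Lemma octmulDr g chi (X Y Y' : octonion R) :
  octmul g chi X (Y + Y') = octmul g chi X Y + octmul g chi X Y'.
Proof. by rewrite -[Y in Y + Y']scale1r octmul_linearr scale1r. Qed.

Lemma octmul0l g chi (Y : octonion R) : octmul g chi 0 Y = 0.
Proof.
by apply/(addrI (octmul g chi 0 Y)); rewrite -octmulDl !addr0.
Qed.

Lemma octmul0r g chi (Y : octonion R) : octmul g chi Y 0 = 0.
Proof.
by apply/(addrI (octmul g chi Y 0)); rewrite -octmulDr !addr0.
Qed.

Lemma octmulZl g chi c (X Y : octonion R) :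
  octmul g chi (c *: X) Y = c *: octmul g chi X Y.
Proof. by rewrite -[c *: X]addr0 octmul_linearl octmul0l addr0. Qed.

Lemma octmulZr g chi c (X Y : octonion R) :
  octmul g chi X (c *: Y) = c *: octmul g chi X Y.
Proof. by rewrite -[c *: Y]addr0 octmul_linearr octmul0r addr0. Qed.

Lemma octmulNl g chi (X Y : octonion R) : octmul g chi (- X) Y = - octmul g chi X Y.
Proof. by rewrite -scaleN1r octmulZl scaleN1r. Qed.

Lemma octmulNr g chi (X Y : octonion R) : octmul g chi X (- Y) = - octmul g chi X Y.
Proof. by rewrite -scaleN1r octmulZr scaleN1r. Qed.

Lemma octmulBl g chi (X X' Y : octonion R) :
  octmul g chi (X - X') Y = octmul g chi X Y - octmul g chi X' Y.
Proof. by rewrite octmulDl octmulNl. Qed.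

Lemma octmulBr g chi (X Y Y' : octonion R) :
  octmul g chi X (Y - Y') = octmul g chi X Y - octmul g chi X Y'.
Proof. by rewrite octmulDr octmulNr. Qed.

Lemma octmul_suml g chi n (F : 'I_n -> octonion R) (Y : octonion R) :
  octmul g chi (\sum_i F i) Y = \sum_i octmul g chi (F i) Y.
Proof.
elim: n F => [|n IH] F; first by rewrite !big_ord0 octmul0l.
by rewrite !big_ord_recl octmulDl IH.
Qed.

Lemma octmul_imag g chi (u v : 'rV[R]_7) :
  octmul g chi (0, u) (0, v) = (- inner g u v, cross g chi u v).
Proof. by rewrite /octmul /= mul0r !scale0r !add0r. Qed.

Lemma octmul1l g chi (X : octonion R) : octmul g chi (1, 0) X = X.
Proof.
have cross0 v : cross g chi 0 v = 0.
  by rewrite cross_sum big1 // => j _; rewrite big1 // => i _; rewrite mxE mulr0 scale0r.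
by rewrite /octmul /= inner0l cross0 mul1r subr0 scale1r scaler0 !addr0; case: X.
Qed.

(** Forms are compared through their cross products, which turns equalities of 3-forms into octonion
    identities. *)
Lemma cross_inj g chi chi' : gram g \in unitmx ->
  (forall u v, cross g chi u v = cross g chi' u v) -> chi = chi'.
Proof.
move=> ug h; apply/funext => -[[|i [|j [|k []]]] // sI].
have := h (delta_mx 0 i) (delta_mx 0 j).
have E (x : tensor 3) : cross g x (delta_mx 0 i) (delta_mx 0 j) = basis_cross g x i j.
  rewrite cross_sum (bigD1 j) //= [X in _ + X]big1 => [|b /negPf nb].
    rewrite addr0 (bigD1 i) //= [X in _ + X]big1 => [|a /negPf na].
      by rewrite addr0 !mxE !eqxx mulr1 scale1r.
    by rewrite !mxE eqxx na mulr0 scale0r.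
  by rewrite big1 // => a _; rewrite !mxE eqxx nb mul0r scale0r.
rewrite !E /basis_cross => /(congr1 (mulmx^~ (gram g))); rewrite /= !mulmxKV //.
move/rowP/(_ k); rewrite !mxE => e.
rewrite (_ : Tuple sI = [tuple i; j; k]) //; exact: val_inj.
Qed.

End Bilinearity.

(** * Stability of G2-structures under sigma_V *)

Section ReflectionDeterminant.
Variable R : comNzRingType.

(** Both sides are the determinant of one block matrix, factored in two ways. *)
Lemma det_add1_mulmx m n (B : 'M[R]_(n, m)) (C : 'M[R]_(m, n)) :
  \det (1%:M + B *m C) = \det (1%:M + C *m B).
Proof.
have E1 : block_mx 1%:M 0 (- B) 1%:M *m block_mx 1%:M C 0 (1%:M + B *m C) =
   block_mx 1%:M C (- B) 1%:M.
  rewrite mulmx_block !(mul1mx, mulmx1, mul0mx, mulmx0, addr0, add0r) mulNmx.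
  by rewrite addrCA addNr addr0.
have E2 : block_mx (1%:M + C *m B) C 0 1%:M *m block_mx 1%:M 0 (- B) 1%:M =
   block_mx 1%:M C (- B) 1%:M.
  by rewrite mulmx_block !(mul1mx, mulmx1, mul0mx, mulmx0, addr0, add0r) mulmxN addrK.
have := congr1 determinant E1; rewrite -E2 !det_mulmx !det_ublock !det_lblock !det1.
by rewrite !mul1r !mulr1.
Qed.

End ReflectionDeterminant.

Section G2Triples.
Variable R : realType.
Local Notation tensor := (cotensor R 7).
Local Notation euclidean := (euclidean R).
Local Notation epsilon := (@levi_civita R 7).
Local Notation phi0 := (phi0 R).
Local Notation psi0 := (dual4 euclidean epsilon phi0).
Local Notation cross0 := (cross euclidean phi0).
Implicit Types (phi chi : tensor 3) (g : tensor 2) (vol : tensor 7).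

Lemma oct_frame_inj (A : 'M[R]_7) : A \in unitmx -> injective (oct_frame A).
Proof.
move=> uA [x u] [y v] [-> /(congr1 (mulmx^~ (invmx A)))] /=.
by rewrite !mulmxK // => ->.
Qed.

Lemma oct_frameB (A : 'M[R]_7) X Y : oct_frame A (X - Y) = oct_frame A X - oct_frame A Y.
Proof. by rewrite /oct_frame /= mulmxBl. Qed.

Lemma oct_frameZ (A : 'M[R]_7) c X : oct_frame A (c *: X) = c *: oct_frame A X.
Proof. by rewrite /oct_frame /= -scalemxAl. Qed.

Lemma oct_frame_conj (A : 'M[R]_7) X : oct_frame A (oct_conj X) = oct_conj (oct_frame A X).
Proof. by rewrite /oct_frame /oct_conj /= mulNmx. Qed.

Lemma octmulK phi g vol (X Y : octonion R) : G2_triple phi g vol ->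
  octmul g phi (octmul g phi X Y) (oct_conj Y) = oct_norm2 g Y *: X.
Proof.
case=> A [uA -> Eg _]; apply: (oct_frame_inj uA).
by rewrite !octmul_frame // oct_frame_conj octmulK0 oct_frameZ -(oct_norm2_frame Y Eg).
Qed.

Lemma oct_conjK : involutive (@oct_conj R).
Proof. by case=> x u; rewrite /oct_conj /= opprK. Qed.

Lemma oct_norm2_conj g (Y : octonion R) : oct_norm2 g (oct_conj Y) = oct_norm2 g Y.
Proof. by rewrite /oct_norm2 /inner /= !mulNmx linearN mulmxN opprK. Qed.

Lemma octmulVK phi g vol (X Y : octonion R) : G2_triple phi g vol ->
  octmul g phi (octmul g phi X (oct_conj Y)) Y = oct_norm2 g Y *: X.
Proof.
by move=> G; rewrite -{2}[Y]oct_conjK (octmulK _ _ G) oct_norm2_conj.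
Qed.

Lemma octmul_cancel phi g vol (X X' Y : octonion R) : G2_triple phi g vol ->
  oct_norm2 g Y = 1 -> octmul g phi X Y = octmul g phi X' Y -> X = X'.
Proof.
move=> G nY h; rewrite -[X]scale1r -[X']scale1r -nY.
by rewrite -!(octmulK _ _ G) h.
Qed.

(** In adapted coordinates this is the eight-square identity. *)
Lemma oct_norm2M phi g vol (X Y : octonion R) : G2_triple phi g vol ->
  oct_norm2 g (octmul g phi X Y) = oct_norm2 g X * oct_norm2 g Y.
Proof.
case=> A [uA -> Eg _]; rewrite !(oct_norm2_frame _ Eg) octmul_frame //.
rewrite -!coord8_norm coord8_mul.
case: (coord8 _) (coord8 _) => ? ? ? ? ? ? ? ? [? ? ? ? ? ? ? ?].
by cbv [mul8 norm8 dot8 cross8 c0 c1 c2 c3 c4 c5 c6 c7]; ring.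
Qed.

Lemma associator4_frame (A : 'M[R]_7) g (psi : tensor 4) t x y :
  A \in unitmx -> gram g = A *m A^T ->
  associator4 g (pullback A psi) t x y *m A =
  associator4 euclidean psi (t *m A) (x *m A) (y *m A).
Proof.
move=> uA Eg; rewrite /associator4 gram_euclidean invmx1 mulmx1 !contract_pullback.
set s := contract (y *m A) _; set r := \row_c s [tuple c].
have -> : \row_c pullback A s [tuple c] = r *m A^T.
  apply/rowP => c; rewrite !mxE pullback_vector; apply: eq_bigr => b _.
  by rewrite !mxE mulrC.
by rewrite -!mulmxA [A^T *m _]mulmxA frame_inverse // mulmx1.
Qed.

Lemma octmul_assoc phi g vol (X Y : octonion R) (t : 'rV[R]_7) : G2_triple phi g vol ->
  octmul g phi (octmul g phi X Y) (0, t) - octmul g phi X (octmul g phi Y (0, t)) =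
  (0, 2 *: associator4 g (dual4 g vol phi) t X.2 Y.2).
Proof.
case=> A [uA -> Eg ->]; apply: (oct_frame_inj uA).
rewrite oct_frameB !octmul_frame // dual4_frame //.
rewrite [oct_frame A (0, t)]/oct_frame [RHS]/oct_frame /= octmul_assoc0.
by rewrite -scalemxAl associator4_frame // associator4_psi0.
Qed.

Lemma octmul_sigma phi g vol (X Y V : octonion R) : G2_triple phi g vol ->
  oct_norm2 g V = 1 ->
  octmul g phi X (octmul g phi Y V) =
  octmul g phi (octmul g (sigma g vol V phi) X Y) V.
Proof.
(* Multiplying on the right by the conjugate of V loses nothing, as |V| = 1, and strips the factor V
   from the right side. *)
move=> G nV; apply: (octmul_cancel (Y := oct_conj V) G); first by rewrite oct_norm2_conj.
rewrite (octmulK _ _ G) nV scale1r.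
case: G => A [uA -> Eg ->]; apply: (oct_frame_inj uA).
have nV0 : oct_norm2 euclidean (oct_frame A V) = 1 by rewrite -(oct_norm2_frame _ Eg).
rewrite sigma_frame // !octmul_frame // oct_frame_conj octmul_sigma_euclidean nV0 ?oner_neq0 //.
by rewrite scale1r.
Qed.

(* For the m-th triple (i, j, k), the component psi0_{lijk} vanishes unless l = m. *)
Definition psi_probe : seq (nat * nat * nat) :=
  [:: (1, 3, 6); (0, 3, 6); (0, 3, 5); (0, 1, 6); (0, 1, 5); (0, 1, 4); (0, 1, 3)]%N.

(** The entries are 2 or -2 because [associatorZ] is twice psi0. *)
Definition psi_probe_value : seq Z := [:: -2; 2; 2; -2; -2; 2; 2]%stdZ.

Lemma psi_probeP : all7 (fun m => let p := nth (0, 0, 0)%N psi_probe m in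
  (p.1.1 < 7)%N && (p.1.2 < 7)%N && (p.2 < 7)%N && ~~ (Z.eqb (nth Z0 psi_probe_value m) Z0) &&
  all7 (fun l => Z.eqb (associatorZ l p.1.1 p.1.2 p.2)
    (if l == m then nth Z0 psi_probe_value m else Z0))).
Proof. by vm_compute. Qed.

Lemma associator4_psi0_inj (t : 'rV[R]_7) :
  (forall x y, associator4 euclidean psi0 t x y = 0) -> t = 0.
Proof.
move=> h; apply/rowP => m; rewrite mxE.
have := all7P m psi_probeP; cbv zeta.
case: (nth _ _ _) => [[i j] k] /= /andP[/andP[/andP[/andP[i7 j7] k7] nz] /allP tab].
have /rowP/(_ (Ordinal k7)) := h (delta_mx 0 (Ordinal i7)) (delta_mx 0 (Ordinal j7)).
rewrite associator4_euclidean (bigD1 (Ordinal j7)) //= [X in _ + X]big1 => [|b /negPf nb];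
  last by rewrite mxE eqxx nb mul0r.
rewrite mxE !eqxx mul1r addr0 (bigD1 (Ordinal i7)) //= [X in _ + X]big1 => [|b /negPf nb];
  last by rewrite mxE eqxx nb mul0r.
rewrite mxE !eqxx mul1r addr0 (bigD1 m) //= [X in _ + X]big1 => [|l /negPf nl].
  rewrite addr0 mxE psi0E.
  have /Z.eqb_eq -> : Z.eqb (associatorZ m i j k) (if m == m then nth Z0 psi_probe_value m else Z0).
    by apply: tab; rewrite mem_iota /=.
  rewrite eqxx; set z := nth _ _ _ => /eqP; rewrite !mulf_eq0 invr_eq0 pnatr_eq0 /=.
  case/orP => [/eqP //|]; rewrite /zR intr_eq0 => z0; case/negP: nz.
  have : z = Z0 by rewrite -[z]int_of_ZK (eqP z0).
  by rewrite /z => ->.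
rewrite psi0E; have /Z.eqb_eq -> : Z.eqb (associatorZ l i j k)
    (if l == m then nth Z0 psi_probe_value m else Z0).
  by apply: (tab l); rewrite mem_iota /=.
by rewrite nl zR0 !mulr0.
Qed.

(** This is why a torsion vector can be recovered from the covariant derivative of its G2-form. *)
Lemma associator4_inj phi g vol (t : 'rV[R]_7) : G2_triple phi g vol ->
  (forall x y, associator4 g (dual4 g vol phi) t x y = 0) -> t = 0.
Proof.
case=> A [uA -> Eg ->] h; suff : t *m A = 0.
  by move/(congr1 (mulmx^~ (invmx A))); rewrite /= mulmxK // mul0mx.
apply: associator4_psi0_inj => x y.
rewrite -[x](mulmxKV uA) -[y](mulmxKV uA) -(associator4_frame _ _ _ _ uA Eg).
by rewrite -(dual4_frame _ uA Eg) h mul0mx.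
Qed.


Lemma cross0C (u v : 'rV[R]_7) : cross0 u v = - cross0 v u.
Proof.
have := coord8_cross (0, u) (0, v); have := coord8_cross (0, v) (0, u) => /= h1 h2.
suff : (0, cross0 u v) = - (0, cross0 v u) :> octonion R by case.
rewrite -scaleN1r -[RHS]addr0 -[X in _ + X](scale0r (0, 0)); apply: coord8_inj.
rewrite coord8_comb h1 h2; apply: oct8P;
  by cbv [comb8 cross8 c0 c1 c2 c3 c4 c5 c6 c7]; ring.
Qed.

Lemma cross0_triple (u v w : 'rV[R]_7) :
  inner euclidean (cross0 u v) w = inner euclidean u (cross0 v w).
Proof.
have h1 := coord8_dot (0, cross0 u v) (0, w); have h2 := coord8_dot (0, u) (0, cross0 v w).
rewrite /= in h1 h2; rewrite -h1 -h2 (coord8_cross (0, u) (0, v)) (coord8_cross (0, v) (0, w)).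
by cbv [dot8 cross8 coord8 fst snd c0 c1 c2 c3 c4 c5 c6 c7]; ring.
Qed.

(** For |w| = 1 this is the half-turn about the line of w, or x |-> w x w^-1 on imaginary octonions;
    it is minus the reflection in the hyperplane orthogonal to w. *)
Definition reflection (w : 'rV[R]_7) : 'M[R]_7 := 2 *: (w^T *m w) - 1%:M.

Lemma mul_reflection (w u : 'rV[R]_7) :
  u *m reflection w = 2 * inner euclidean u w *: w - u.
Proof.
rewrite /reflection mulmxBr mulmx1 -scalemxAr mulmxA; congr (_ - _).
rewrite -scalerA; congr (_ *: _).
by rewrite [u *m w^T]mx11_scalar mul_scalar_mx /inner gram_euclidean mulmx1.
Qed.

Lemma reflection_tr w : (reflection w)^T = reflection w.
Proof. by rewrite /reflection linearB linearZ /= trmx_mul trmxK trmx1. Qed.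

Lemma reflectionK (w : 'rV[R]_7) : inner euclidean w w = 1 ->
  reflection w *m reflection w = 1%:M.
Proof.
move=> w1; rewrite /reflection; set P := w^T *m w.
have PP : P *m P = P.
  rewrite /P mulmxA -[w^T *m w *m _]mulmxA [w *m w^T]mx11_scalar.
  by rewrite (_ : (w *m w^T) 0 0 = 1) ?mulmx1 // -w1 /inner gram_euclidean mulmx1.
rewrite mulmxBl mul1mx mulmxBr mulmx1 -scalemxAl -scalemxAr PP; move: P {PP} => P.
by apply/matrixP => i j; rewrite !mxE; ring.
Qed.

(** The half-turn is -(1 - 2 w^T w). The bracket has determinant 1 - 2 |w|^2 = -1 by
    [det_add1_mulmx], and the sign in front contributes (-1)^7. *)
Lemma det_reflection (w : 'rV[R]_7) : inner euclidean w w = 1 -> \det (reflection w) = 1.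
Proof.
move=> w1; have ww : w *m w^T = 1%:M.
  rewrite [LHS]mx11_scalar; congr (_%:M); rewrite -w1 /inner gram_euclidean mulmx1 //.
have -> : reflection w = (-1) *: (1%:M + w^T *m (-2 *: w)).
  rewrite /reflection -scalemxAr; move: (w^T *m w) => P.
  by apply/matrixP => i j; rewrite !mxE; ring.
rewrite detZ det_add1_mulmx -scalemxAl ww det_mx11 !mxE -signr_odd /=; ring.
Qed.

(** Both forms are compared through their cross products. With zero real part the associator term of
    sigma disappears, and the rest matches the expansion of R(Ru x Rv), R being the half-turn about
    w. *)
Lemma sigma_imag_euclidean (w : 'rV[R]_7) : inner euclidean w w = 1 ->
  sigma euclidean epsilon (0, w) phi0 = pullback (reflection w) phi0.
Proof.
move=> w1; have uM : reflection w \in unitmx.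
  by case/mulmx1_unit: (reflectionK w1).
have EM : gram euclidean = reflection w *m (reflection w)^T.
  by rewrite gram_euclidean reflection_tr reflectionK.
apply: (@cross_inj _ euclidean) => [|u v]; first by rewrite gram_euclidean unitmx1.
have := cross_frame phi0 u v uM EM => /(congr1 (mulmx^~ (reflection w))) /=.
rewrite -mulmxA reflectionK // mulmx1 => ->.
rewrite cross_sigma0 /= !mul_reflection /oct_norm2 /= expr0n /= w1 !add0r invr1 !scale1r.
have ww : cross0 w w = 0.
  have h := cross0C w w; apply/rowP => k; have := congr1 (fun x : 'rV_7 => x 0 k) h.
  by move: (cross0 w w) => x; rewrite !mxE; lra.
have crossNl x y : cross0 (- x) y = - cross0 x y.
  by rewrite !cross_sum -sumrN; apply: eq_bigr => j _; rewrite -sumrN; apply: eq_bigr => i _;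
    rewrite !mxE mulrN scaleNr.
have crossNr x y : cross0 x (- y) = - cross0 x y by rewrite cross0C crossNl -cross0C.
rewrite cross_linearl !crossNl !cross_linearr !crossNr ww (cross0C u w).
have innerC x y : inner euclidean x y = inner euclidean y x.
  by rewrite !inner_euclidean_sum; apply: eq_bigr => i _; rewrite mulrC.
have w0 x : inner euclidean (cross0 w x) w = 0.
  by rewrite innerC -cross0_triple ww /inner !mul0mx mxE.
rewrite (innerC w u) (innerC w v) (cross0_triple w u v) (innerC w (cross0 u v)).
set a := inner _ u w; set b := inner _ v w.
(* X is the cross product of the two rotated vectors; its terms in w x v and w x u are orthogonal to
   w and contribute nothing to <X, w>. *)
set X := (X in _ = (2 * inner _ X w) *: w - _).
have -> : inner euclidean X w = inner euclidean (cross0 u v) w.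
  have -> : X = (- (2 * a)) *: cross0 w v + ((2 * b) *: cross0 w u + cross0 u v).
    rewrite /X; move: (cross0 w v) (cross0 w u) (cross0 u v) => x y z.
    by apply/rowP => k; rewrite !mxE; ring.
  by rewrite !inner_linearl !w0 !mulr0 !add0r.
rewrite /X; move: (assoc_vector w u v) (cross0 w v) (cross0 w u) (cross0 u v) => s x y z.
by apply/rowP => k; rewrite !mxE; ring.
Qed.

Lemma G2_triple_sigma_imag phi g vol (w : 'rV[R]_7) : G2_triple phi g vol ->
  inner g w w = 1 -> G2_triple (sigma g vol (0, w) phi) g vol.
Proof.
(* The old frame followed by the half-turn: orthogonality keeps the metric, determinant 1 keeps the
   volume form. *)
case=> A [uA -> Eg ->] w1; exists (A *m reflection (w *m A)).
have w1' : inner euclidean (w *m A) (w *m A) = 1 by rewrite -(inner_frame w w Eg).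
have RR := reflectionK w1'; split.
- by rewrite unitmx_mul uA; case/mulmx1_unit: RR.
- by rewrite sigma_frame // /oct_frame /= sigma_imag_euclidean // pullback_comp.
- by rewrite trmx_mul reflection_tr mulmxA -[A *m _ *m _]mulmxA RR mulmx1.
rewrite -pullback_comp; congr pullback; rewrite pullback_levi_civita det_reflection //.
by apply/funext => I; rewrite mul1r.
Qed.

Lemma unit_orthogonal phi g vol (v : 'rV[R]_7) : G2_triple phi g vol ->
  exists w, inner g w w = 1 /\ inner g v w = 0.
Proof.
case=> A [uA _ Eg _]; have ug := gram_frame_unit uA Eg.
(* The orthogonal complement of v is the kernel of a single column, hence nonzero in dimension 7. *)
pose K := kermx (gram g *m v^T).
have K0 : K != 0.
  rewrite -mxrank_eq0 mxrank_ker -lt0n subn_gt0.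
  by apply: leq_ltn_trans (rank_leq_col _) _.
have [w wK w0] : exists2 w : 'rV[R]_7, (w <= K)%MS & w != 0.
  by exists (nz_row K); [exact: nz_row_sub | rewrite nz_row_eq0].
have vw : inner g w v = 0 by rewrite /inner -mulmxA (sub_kermxP wK) mxE.
have symg u u' : inner g u u' = inner g u' u.
  rewrite !(inner_frame _ _ Eg) !inner_euclidean_sum; apply: eq_bigr => i _.
  by rewrite mulrC.
have n0 : 0 < inner g w w.
  have wA0 : w *m A != 0.
    by apply: contra w0 => /eqP /(congr1 (mulmx^~ (invmx A))); rewrite /= mulmxK // mul0mx => ->.
  rewrite (inner_frame _ _ Eg) inner_euclidean_sum lt_neqAle sumr_ge0 ?andbT;
    last by move=> i _; rewrite -expr2 sqr_ge0.
  rewrite eq_sym psumr_neq0 //; last by move=> i _; rewrite -expr2 sqr_ge0.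
  have [i wi] := rV0Pn _ wA0.
  by apply/hasP; exists i; rewrite ?mem_index_enum // -expr2 lt_neqAle sqr_ge0 andbT eq_sym sqrf_eq0.
exists ((Num.sqrt (inner g w w))^-1 *: w); split.
  rewrite innerZl innerZr mulrA -invfM -expr2 sqr_sqrtr ?mulVf ?gt_eqF //.
  exact: ltW.
by rewrite innerZr symg vw mulr0.
Qed.

(* V is a product u w of two imaginary units, and then
   sigma_V(phi) = sigma_u(sigma_w(phi)). *)
Lemma G2_triple_sigma phi g vol (V : octonion R) : G2_triple phi g vol ->
  oct_norm2 g V = 1 -> G2_triple (sigma g vol V phi) g vol.
Proof.
move=> G nV; have [w [w1 vw]] := unit_orthogonal V.2 G.
(* The real part of u is <Im V, w> = 0, so u is imaginary; and V = u w because |w| = 1. *)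
pose u := octmul g phi V (oct_conj (0, w)).
have u0 : u.1 = 0.
  rewrite /u /octmul /oct_conj /= mulr0 sub0r /inner linearN mulmxN mxE opprK.
  by rewrite -[LHS]/(inner g V.2 w).
have Eu : u = (0, u.2) by rewrite -u0; case: u {u0}.
have nw : oct_norm2 g (0, w) = 1 by rewrite /oct_norm2 /= expr0n add0r.
have nu : oct_norm2 g u = 1 by rewrite (oct_norm2M _ _ G) oct_norm2_conj nV nw mulr1.
have u1 : inner g u.2 u.2 = 1 by have := nu; rewrite /oct_norm2 u0 expr0n add0r.
have EV : V = octmul g phi u (0, w) by rewrite (octmulVK _ _ G) nw scale1r.
have Gw := G2_triple_sigma_imag G w1.
have Guw := G2_triple_sigma_imag Gw u1.
suff -> : sigma g vol V phi = sigma g vol (0, u.2) (sigma g vol (0, w) phi) by [].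
have ug : gram g \in unitmx by case: G => A [uA _ Eg _]; apply: gram_frame_unit Eg.
apply: (cross_inj ug) => a b.
(* The product a(b(uw)) is regrouped by [octmul_sigma] for w, then for u over sigma_w(phi), and once
   more for w; V is then cancelled. *)
have := octmul_sigma (0, a) (0, b) G nV.
rewrite {1 2}EV (octmul_sigma _ _ G nw) (octmul_sigma _ _ G nw) -Eu.
rewrite (octmul_sigma _ _ Gw nu) -(octmul_sigma _ _ G nw) -EV.
move/(octmul_cancel G nV); by rewrite !octmul_imag => -[->].
Qed.

End G2Triples.

(** * Directional derivatives of sums, products and inverse matrices *)

Section DirectionalDerivatives.
Variables (R : realType) (d : nat) (y e : 'rV[R]_d).
Implicit Types (f h : 'rV[R]_d -> R).

Lemma is_derive_add f h df dh : is_derive y e f df -> is_derive y e h dh ->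
  is_derive y e (fun z => f z + h z) (df + dh).
Proof. exact: is_deriveD. Qed.

Lemma is_derive_mul f h df dh : is_derive y e f df -> is_derive y e h dh ->
  is_derive y e (fun z => f z * h z) (df * h y + f y * dh).
Proof.
move=> Hf Hh; apply: (is_derive_eq (is_deriveM Hf Hh)).
by rewrite addrC mulrC.
Qed.

Lemma is_derive_const (c : R) : is_derive y e (fun=> c) 0.
Proof. exact: is_derive_cst. Qed.

Lemma is_derive_bigsum (I : Type) (r : seq I) (P : pred I) (f : I -> 'rV[R]_d -> R) df :
  (forall i, is_derive y e (f i) (df i)) ->
  is_derive y e (fun z => \sum_(i <- r | P i) f i z) (\sum_(i <- r | P i) df i).
Proof.
move=> H; elim: r => [|i r IH].
  rewrite big_nil (_ : (fun z => _) = fun=> 0); first exact: is_derive_const.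
  by apply/funext => z; rewrite big_nil.
rewrite big_cons (_ : (fun z => _) =
  fun z => if P i then f i z + \sum_(j <- r | P j) f j z else \sum_(j <- r | P j) f j z);
  last by apply/funext => z; rewrite big_cons.
by case: (P i) => //; apply: is_derive_add.
Qed.

Lemma derivable_prod_seq (I : Type) (r : seq I) (f : I -> 'rV[R]_d -> R) :
  (forall i, derivable (f i) y e) -> derivable (fun z => \prod_(i <- r) f i z) y e.
Proof.
move=> H; elim: r => [|i r IH].
  rewrite (_ : (fun z => _) = fun=> 1); first exact: derivable_cst.
  by apply/funext => z; rewrite big_nil.
rewrite (_ : (fun z => _) = fun z => f i z * \prod_(j <- r) f j z);
  last by apply/funext => z; rewrite big_cons.
exact: derivableM.
Qed.

Lemma derivable_bigsum (I : Type) (r : seq I) (P : pred I) (f : I -> 'rV[R]_d -> R) :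
  (forall i, derivable (f i) y e) ->
  derivable (fun z => \sum_(i <- r | P i) f i z) y e.
Proof.
move=> H; have K : forall i, is_derive y e (f i) ('D_e (f i) y).
  by move=> i; apply: derivableP.
by have [] := is_derive_bigsum r P K.
Qed.

Definition mx_derive m n (F : 'rV[R]_d -> 'M[R]_(m, n)) (dF : 'M[R]_(m, n)) : Prop :=
  forall i j, is_derive y e (fun z => F z i j) (dF i j).

Lemma mx_derive_mul m n p (F : 'rV[R]_d -> 'M[R]_(m, n)) (H : 'rV[R]_d -> 'M[R]_(n, p))
    dF dH : mx_derive F dF -> mx_derive H dH ->
  mx_derive (fun z => F z *m H z) (dF *m H y + F y *m dH).
Proof.
move=> HF HH i j.
rewrite (_ : (fun z => _) = fun z => \sum_k F z i k * H z k j);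
  last by apply/funext => z; rewrite mxE.
rewrite !mxE -big_split /=; apply: is_derive_bigsum => k.
exact: is_derive_mul.
Qed.

Lemma mx_derive_unique m n (F H : 'rV[R]_d -> 'M[R]_(m, n)) dF dH :
  (\near y, F y = H y) -> mx_derive F dF -> mx_derive H dH -> dF = dH.
Proof.
move=> FH HF HH; apply/matrixP => i j.
have [_ <-] := HF i j; have [_ <-] := HH i j; apply: near_eq_derive.
by apply: filterS FH => z ->.
Qed.

Lemma derivable_det n (F : 'rV[R]_d -> 'M[R]_n) :
  (forall i j, derivable (fun z => F z i j) y e) -> derivable (fun z => \det (F z)) y e.
Proof.
move=> H; rewrite /determinant; apply: derivable_bigsum => s.
apply: derivableM; first exact: derivable_cst.
by apply: derivable_prod_seq => i.
Qed.

(** Cofactors express the inverse through determinants. Invertibility is asked for near y because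
    [invmx] of a singular matrix is that matrix itself. *)
Lemma mx_derivable_inv n (F : 'rV[R]_d -> 'M[R]_n) :
  (\near y, F y \in unitmx) -> (forall i j, derivable (fun z => F z i j) y e) ->
  forall i j, derivable (fun z => invmx (F z) i j) y e.
Proof.
move=> uF HF i j.
apply: (@near_eq_derivable _ _ _ (fun z => (\det (F z))^-1 * cofactor (F z) j i)).
  by apply: filterS uF => z uz; rewrite /invmx uz !mxE.
apply: derivableM.
  apply: derivableV; last exact: derivable_det.
  by have := nbhs_singleton uF; rewrite unitmxE unitfE.
rewrite /cofactor; apply: derivableM; first exact: derivable_cst.
apply: derivable_det => k l.
rewrite (_ : (fun z => _) = fun z => F z (lift j k) (lift i l)) //.
by apply/funext => z; rewrite !mxE.
Qed.

End DirectionalDerivatives.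

(** * Leibniz rules for the Levi-Civita connection *)

Section Leibniz.
Variables (R : realType) (y : 'rV[R]_7) (a : 'I_7).
Local Notation tensor := (cotensor R 7).
Local Notation e := (delta_mx 0 a : 'rV[R]_7).
Variable g : 'rV[R]_7 -> tensor 2.
Hypothesis g_derivable : forall i j, derivable (fun z => g z [tuple i; j]) y e.
Hypothesis g_sym : \near y, forall i j, g y [tuple i; j] = g y [tuple j; i].
Hypothesis g_unit : \near y, gram (g y) \in unitmx.

(** Indexed so that the covariant derivative of a row vector v in direction a is dv + v *m N. *)
Definition connection : 'M[R]_7 := \matrix_(j, k) christoffel g y k a j.
Local Notation N := connection.

Definition gram_derivative : 'M[R]_7 :=
  \matrix_(i, j) partial a (fun z => g z [tuple i; j]) y.

Lemma gram_mx_derive : mx_derive y e (fun z => gram (g z)) gram_derivative.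
Proof.
move=> i j; rewrite (_ : (fun z => _) = fun z => g z [tuple i; j]).
  by rewrite mxE; apply: derivableP.
by apply/funext => z; rewrite mxE.
Qed.

Lemma partial_gC b i j : partial b (fun z => g z [tuple i; j]) y =
  partial b (fun z => g z [tuple j; i]) y.
Proof. by apply: near_eq_derive; apply: filterS g_sym => z ->. Qed.

(** This is nabla g = 0. N times the Gram matrix is half of the matrix C of the Christoffel formula,
    and in C plus its transpose all but the derivatives along a cancel. *)
Lemma metric_compatible :
  gram_derivative = N *m gram (g y) + gram (g y) *m N^T.
Proof.
have Gs : (gram (g y))^T = gram (g y).
  by apply/matrixP => i j; rewrite !mxE; have /(_ j i) := nbhs_singleton g_sym.
pose C i l := partial a (fun z => g z [tuple i; l]) y +
  partial i (fun z => g z [tuple a; l]) y - partial l (fun z => g z [tuple a; i]) y.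
have NE : N = 2^-1 *: (\matrix_(i, l) C i l *m invmx (gram (g y))).
  apply/matrixP => i k; rewrite !mxE /christoffel; congr (_ * _).
  apply: eq_bigr => l _; rewrite mxE mulrC; congr (_ * _).
  by rewrite -[in LHS]Gs -trmx_inv mxE.
have NG : N *m gram (g y) = 2^-1 *: \matrix_(i, l) C i l.
  by rewrite NE -scalemxAl mulmxKV // (nbhs_singleton g_unit).
have -> : gram (g y) *m N^T = (N *m gram (g y))^T by rewrite trmx_mul Gs.
rewrite NG; apply/matrixP => i j; rewrite !mxE /C (partial_gC a j i).
by field.
Qed.

(** The index stays down, so that the product rule applies before the inverse metric enters. *)
Definition lowered_cross (X Y : 'rV[R]_7) (chi : tensor 3) : 'rV[R]_7 :=
  \row_c \sum_j Y 0 j * \sum_i X 0 i * chi [tuple i; j; c].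

Lemma crossE_lowered h chi (X Y : 'rV[R]_7) :
  cross h chi X Y = lowered_cross X Y chi *m invmx (gram h).
Proof.
by rewrite /cross; congr (_ *m _); apply/rowP => c; rewrite !mxE.
Qed.

Lemma nabla_cotensor3 chi i j k :
  nabla_cotensor g chi y a [tuple i; j; k] =
  partial a (fun z => chi z [tuple i; j; k]) y -
  (\sum_l N i l * chi y [tuple l; j; k] + \sum_l N j l * chi y [tuple i; l; k] +
   \sum_l N k l * chi y [tuple i; j; l]).
Proof.
have sum3 (F : 'I_3 -> R) : \sum_s F s = F ord0 + F (lift ord0 ord0) +
    F (lift ord0 (lift ord0 ord0)).
  by rewrite !big_ord_recl big_ord0 addr0 addrA.
rewrite /nabla_cotensor sum3; congr (_ - (_ + _ + _)).
- apply: eq_bigr => l _; rewrite mxE; congr (_ * chi y _).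
  by apply/eq_from_tnth => s; rewrite tnth_mktuple; case: s => -[|[|[|s]]].
- apply: eq_bigr => l _; rewrite mxE; congr (_ * chi y _).
  by apply/eq_from_tnth => s; rewrite tnth_mktuple; case: s => -[|[|[|s]]].
- apply: eq_bigr => l _; rewrite mxE; congr (_ * chi y _).
  by apply/eq_from_tnth => s; rewrite tnth_mktuple; case: s => -[|[|[|s]]].
Qed.

Lemma nabla_vectorE v dv : mx_derive y e v dv ->
  nabla_vector g e v y = dv + v y *m N.
Proof.
move=> Hv; apply/rowP => k; rewrite !mxE; congr (_ + _).
  rewrite /nabla_fun (bigD1 a) //= mxE !eqxx mul1r big1 ?addr0 => [|i /negPf ni].
    by have [_ <-] := Hv 0 k.
  by rewrite mxE ni andbF mul0r.
rewrite (bigD1 a) //= [X in _ + X]big1 ?addr0 => [|i /negPf ni].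
  by apply: eq_bigr => j _; rewrite !mxE !eqxx mulr1 mulrC.
by rewrite big1 // => j _; rewrite mxE ni andbF mulr0 mul0r.
Qed.

Lemma lowered_cross_derive X Y chi dX dY dchi :
  mx_derive y e X dX -> mx_derive y e Y dY ->
  (forall i j k, is_derive y e (fun z => chi z [tuple i; j; k]) (dchi [tuple i; j; k])) ->
  mx_derive y e (fun z => lowered_cross (X z) (Y z) (chi z))
    (lowered_cross dX (Y y) (chi y) + lowered_cross (X y) dY (chi y) +
     lowered_cross (X y) (Y y) dchi).
Proof.
move=> HX HY Hc i0 c.
rewrite (_ : (fun z => _) =
  fun z => \sum_j Y z 0 j * \sum_i X z 0 i * chi z [tuple i; j; c]);
  last by apply/funext => z; rewrite mxE.
rewrite !mxE -!big_split /=.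
rewrite (eq_bigr (fun j => dY 0 j * (\sum_i X y 0 i * chi y [tuple i; j; c]) +
  Y y 0 j * \sum_i (dX 0 i * chi y [tuple i; j; c] + X y 0 i * dchi [tuple i; j; c]))).
  apply: is_derive_bigsum => j; apply: is_derive_mul; first exact: HY.
  by apply: is_derive_bigsum => i; apply: is_derive_mul => //; exact: HX.
by move=> j _; rewrite big_split /= mulrDr; ring.
Qed.

Lemma lowered_crossDl X X' Y chi :
  lowered_cross (X + X') Y chi = lowered_cross X Y chi + lowered_cross X' Y chi.
Proof.
apply/rowP => c; rewrite !mxE -big_split /=; apply: eq_bigr => j _.
rewrite -mulrDr -big_split /=; congr (_ * _); apply: eq_bigr => i _.
by rewrite mxE mulrDl.
Qed.

Lemma lowered_crossDr X Y Y' chi :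
  lowered_cross X (Y + Y') chi = lowered_cross X Y chi + lowered_cross X Y' chi.
Proof.
apply/rowP => c; rewrite !mxE -big_split /=; apply: eq_bigr => j _.
by rewrite mxE mulrDl.
Qed.

Lemma lowered_cross_nabla X Y chi (dchi : tensor 3) :
  (forall i j k, partial a (fun z => chi z [tuple i; j; k]) y = dchi [tuple i; j; k]) ->
  lowered_cross X Y (nabla_cotensor g chi y a) =
  lowered_cross X Y dchi - (lowered_cross (X *m N) Y (chi y) +
    lowered_cross X (Y *m N) (chi y) + lowered_cross X Y (chi y) *m N^T).
Proof.
move=> Hd; apply/rowP => c.
have E1 : lowered_cross (X *m N) Y (chi y) 0 c =
    \sum_j Y 0 j * \sum_i X 0 i * \sum_l N i l * chi y [tuple l; j; c].
  rewrite mxE; apply: eq_bigr => j _; congr (_ * _).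
  under eq_bigr => l _ do rewrite mxE mulr_suml.
  rewrite exchange_big /=; apply: eq_bigr => i _; rewrite mulr_sumr.
  by apply: eq_bigr => l _; rewrite mulrA.
have E2 : lowered_cross X (Y *m N) (chi y) 0 c =
    \sum_j Y 0 j * \sum_i X 0 i * \sum_l N j l * chi y [tuple i; l; c].
  rewrite mxE; under eq_bigr => l _ do rewrite mxE mulr_suml.
  rewrite exchange_big /=; apply: eq_bigr => j _.
  under eq_bigr => l _ do rewrite -mulrA mulr_sumr.
  rewrite -mulr_sumr exchange_big /=; congr (_ * _); apply: eq_bigr => i _.
  by rewrite mulr_sumr; apply: eq_bigr => l _; ring.
have E3 : (lowered_cross X Y (chi y) *m N^T) 0 c =
    \sum_j Y 0 j * \sum_i X 0 i * \sum_l N c l * chi y [tuple i; j; l].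
  rewrite mxE; under eq_bigr => l _ do rewrite [N^T _ _]mxE mxE mulr_suml.
  rewrite exchange_big /=; apply: eq_bigr => j _.
  under eq_bigr => l _ do rewrite -mulrA mulr_suml.
  rewrite -mulr_sumr exchange_big /=; congr (_ * _); apply: eq_bigr => i _.
  by rewrite mulr_sumr; apply: eq_bigr => l _; ring.
move: E1 E2 E3.
move: (lowered_cross (X *m N) Y (chi y)) (lowered_cross X (Y *m N) (chi y)) => x1 x2.
move: (lowered_cross X Y (chi y) *m N^T) => x3 E1 E2 E3.
have -> : (lowered_cross X Y dchi - (x1 + x2 + x3)) 0 c =
  lowered_cross X Y dchi 0 c - (x1 0 c + x2 0 c + x3 0 c).
  by move: (lowered_cross X Y dchi) => x4; rewrite !mxE.
rewrite E1 E2 E3 !mxE -!big_split -sumrB /=; apply: eq_bigr => j _.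
rewrite -!mulrDr -mulrBr; congr (_ * _).
rewrite -!big_split -sumrB /=; apply: eq_bigr => i _; rewrite -!mulrDr -mulrBr.
by rewrite nabla_cotensor3 Hd.
Qed.

(** The inverse Gram matrix is only known to have some derivative. Differentiating lowered = cross
    *m gram and solving for the derivative of the cross product avoids its value;
    [metric_compatible] then replaces the derivative of the Gram matrix. *)
Lemma nabla_cross X Y chi dX dY :
  mx_derive y e X dX -> mx_derive y e Y dY ->
  (forall i j k, derivable (fun z => chi z [tuple i; j; k]) y e) ->
  exists2 dc, mx_derive y e (fun z => cross (g z) (chi z) (X z) (Y z)) dc &
  dc + cross (g y) (chi y) (X y) (Y y) *m N =
  cross (g y) (chi y) (dX + X y *m N) (Y y) + cross (g y) (chi y) (X y) (dY + Y y *m N)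
  + cross (g y) (nabla_cotensor g chi y a) (X y) (Y y).
Proof.
move=> HX HY Hchi.
pose dchi : tensor 3 := fun I => partial a (fun z => chi z I) y.
have Hc i j k : is_derive y e (fun z => chi z [tuple i; j; k]) (dchi [tuple i; j; k]).
  exact: derivableP.
have Hr := lowered_cross_derive HX HY Hc.
set dr := (X in mx_derive _ _ _ X) in Hr.
pose dH : 'M[R]_7 := \matrix_(i, j) 'D_e (fun z => invmx (gram (g z)) i j) y.
have HH : mx_derive y e (fun z => invmx (gram (g z))) dH.
  move=> i j; rewrite mxE; apply: derivableP; apply: mx_derivable_inv => // k l.
  by have [] := gram_mx_derive k l.
have Hcr := mx_derive_mul Hr HH.
set r := fun z => lowered_cross (X z) (Y z) (chi z) in Hr Hcr.
set dc := (X in mx_derive _ _ _ X) in Hcr.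
have Ecr : (fun z => cross (g z) (chi z) (X z) (Y z)) = fun z => r z *m invmx (gram (g z)).
  by apply/funext => z; rewrite crossE_lowered.
exists dc; first by rewrite Ecr.
have uG := nbhs_singleton g_unit.
have Edr : dr = dc *m gram (g y) + (r y *m invmx (gram (g y))) *m gram_derivative.
  apply: (mx_derive_unique _ Hr (mx_derive_mul Hcr gram_mx_derive)).
  by apply: filterS g_unit => z uz; rewrite mulmxKV.
rewrite !crossE_lowered -!mulmxDl -/(r y).
rewrite -[LHS](mulmxK uG); congr (_ *m _).
rewrite mulmxDl; move/eqP: Edr; rewrite -subr_eq => /eqP <-.
rewrite metric_compatible mulmxDr !mulmxA mulmxKV // opprD addrA addrAC subrK.
rewrite lowered_crossDl lowered_crossDr (@lowered_cross_nabla _ _ chi dchi) // -/(r y) /dr.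
move: (lowered_cross dX _ _) (lowered_cross _ dY _) (lowered_cross _ _ dchi) => x1 x2 x3.
move: (lowered_cross (X y *m N) _ _) (lowered_cross _ (Y y *m N) _) (r y *m N^T) => x4 x5 x6.
by apply/rowP => k; rewrite !mxE; ring.
Qed.

Lemma nabla_inner X Y dX dY :
  mx_derive y e X dX -> mx_derive y e Y dY ->
  is_derive y e (fun z => inner (g z) (X z) (Y z))
    (inner (g y) (dX + X y *m N) (Y y) + inner (g y) (X y) (dY + Y y *m N)).
Proof.
move=> HX HY; have HYT : mx_derive y e (fun z => (Y z)^T) dY^T.
  move=> i j; rewrite (_ : (fun z => _) = fun z => Y z j i); first by rewrite mxE; exact: HY.
  by apply/funext => z; rewrite mxE.
have := mx_derive_mul (mx_derive_mul HX gram_mx_derive) HYT 0 0.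
move=> h; apply: (is_derive_eq h); rewrite metric_compatible /inner.
rewrite [(dY + _)^T]linearD /= trmx_mul !mulmxDl !mulmxDr !mulmxDl !mulmxA.
rewrite !mxE; ring.
Qed.

Definition derivable_section (A : 'rV[R]_7 -> octonion R) : Prop :=
  derivable (fun z => (A z).1) y e /\
  forall k, derivable (fun z => (A z).2 0 k) y e.

(** The 3-tensor chi is left free because the rule serves both phi and sigma_V(phi); the last term
    measures how far chi is from parallel. *)
Lemma nabla_octmul (A B : 'rV[R]_7 -> octonion R) chi :
  derivable_section A -> derivable_section B ->
  (forall i j k, derivable (fun z => chi z [tuple i; j; k]) y e) ->
  derivable_section (fun z => octmul (g z) (chi z) (A z) (B z)) /\
  nabla_oct g e (fun z => octmul (g z) (chi z) (A z) (B z)) y =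
  octmul (g y) (chi y) (nabla_oct g e A y) (B y) +
  octmul (g y) (chi y) (A y) (nabla_oct g e B y) +
  (0, cross (g y) (nabla_cotensor g chi y a) (A y).2 (B y).2).
Proof.
move=> [A1 A2] [B1 B2] Hchi.
have mxd (v : 'rV[R]_7 -> 'rV[R]_7) : (forall k, derivable (fun z => v z 0 k) y e) ->
    mx_derive y e v (\row_k 'D_e (fun z => v z 0 k) y).
  by move=> H i j; rewrite mxE (ord1 i); apply: derivableP.
have HA := mxd _ A2; have HB := mxd _ B2.
set dA := \row_k _ in HA; set dB := \row_k _ in HB.
have [dc Hc Ec] := nabla_cross HA HB Hchi.
have Hi := nabla_inner HA HB.
have nfun f df : is_derive y e f df -> nabla_fun e f y = df.
  move=> Hf; rewrite /nabla_fun (bigD1 a) //= mxE !eqxx mul1r big1 ?addr0 => [|i /negPf ni].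
    by have [_ <-] := Hf.
  by rewrite mxE ni andbF mul0r.
have HA1 := derivableP A1; have HB1 := derivableP B1.
set da := 'D_e _ y in HA1; set db := 'D_e _ y in HB1.
have H1 : is_derive y e (fun z => (octmul (g z) (chi z) (A z) (B z)).1)
   (da * (B y).1 + (A y).1 * db -
    (inner (g y) (dA + (A y).2 *m N) (B y).2 + inner (g y) (A y).2 (dB + (B y).2 *m N))).
  by apply: is_deriveB Hi; apply: is_derive_mul.
have H2 : mx_derive y e (fun z => (octmul (g z) (chi z) (A z) (B z)).2)
   (da *: (B y).2 + (A y).1 *: dB + (db *: (A y).2 + (B y).1 *: dA) + dc).
  move=> i k; rewrite (ord1 i) (_ : (fun z => _) = fun z => (A z).1 * (B z).2 0 k +
    (B z).1 * (A z).2 0 k + cross (g z) (chi z) (A z).2 (B z).2 0 k); last first.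
    by apply/funext => z; rewrite /=; move: (cross _ _ _ _) => x; rewrite !mxE.
  have -> : (da *: (B y).2 + (A y).1 *: dB + (db *: (A y).2 + (B y).1 *: dA) + dc) 0 k =
    (da * (B y).2 0 k + (A y).1 * dB 0 k) + (db * (A y).2 0 k + (B y).1 * dA 0 k) + dc 0 k.
    by move: dA dB dc {HA HB Hc Ec Hi H1} => dA dB dc; rewrite !mxE.
  exact: (is_derive_add (is_derive_add (is_derive_mul HA1 (HB 0 k))
    (is_derive_mul HB1 (HA 0 k))) (Hc 0 k)).
split.
  by split=> [|k]; [have [] := H1 | have [] := H2 0 k].
rewrite /nabla_oct (nfun _ _ H1) (nabla_vectorE H2) (nabla_vectorE HA) (nabla_vectorE HB).
rewrite (nfun _ _ HA1) (nfun _ _ HB1).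
apply: oct_eqP; first by rewrite !oct_compE /=; ring.
move=> k; congr (fun x : 'rV_7 => x 0 k); rewrite !oct_compE /= !mulmxDl addrACA.
rewrite Ec; move: (cross _ _ _ _) (cross _ _ _ _) (cross _ _ _ _) => x1 x2 x3.
rewrite -!scalemxAl; move: (_ *m N) (_ *m N) => x4 x5.
by apply/rowP => l; move: dA dB {HA HB Hc Ec Hi H1 H2} => dA dB; rewrite !mxE; ring.
Qed.

End Leibniz.

(** * Algebra of the torsion: associators and contractions *)

Section TorsionAlgebra.
Variable R : realType.
Local Notation tensor := (cotensor R 7).
Implicit Types (phi chi : tensor 3) (g : tensor 2) (vol : tensor 7).

Lemma associator4_sum g (psi : tensor 4) (t x y : 'rV[R]_7) :
  associator4 g psi t x y =
  (\row_k \sum_j y 0 j * \sum_i x 0 i * \sum_l t 0 l * psi [tuple l; i; j; k])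
    *m invmx (gram g).
Proof. by congr (_ *m _); apply/rowP => k; rewrite !mxE. Qed.

Lemma associator4B g (psi : tensor 4) (t t' x y : 'rV[R]_7) :
  associator4 g psi (t - t') x y = associator4 g psi t x y - associator4 g psi t' x y.
Proof.
rewrite !associator4_sum -mulmxBl; congr (_ *m _); apply/rowP => k.
rewrite !mxE -sumrB; apply: eq_bigr => j _; rewrite -mulrBr; congr (_ * _).
rewrite -sumrB; apply: eq_bigr => i _; rewrite -mulrBr; congr (_ * _).
by rewrite -sumrB; apply: eq_bigr => l _; rewrite !mxE mulrBl.
Qed.

(** Applied with chi the covariant derivative of a G2-form in a fixed direction and t the torsion
    vector of that direction. *)
Lemma cross_torsion g chi (psi : tensor 4) (t x y : 'rV[R]_7) :
  (forall i j k, chi [tuple i; j; k] = 2 * \sum_l t 0 l * psi [tuple l; i; j; k]) ->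
  cross g chi x y = 2 *: associator4 g psi t x y.
Proof.
move=> E; rewrite crossE_lowered associator4_sum scalemxAl; congr (_ *m _).
apply/rowP => k; rewrite !mxE mulr_sumr; apply: eq_bigr => j _.
rewrite mulrCA; congr (_ * _); rewrite mulr_sumr; apply: eq_bigr => i _.
by rewrite E mulrCA.
Qed.

(** The real part is <V t, V> = |V|^2 <t, 1>, and t is imaginary. *)
Lemma octmul_conj_real phi g vol (V : octonion R) (t : 'rV[R]_7) : G2_triple phi g vol ->
  (octmul g phi (octmul g phi V (0, t)) (oct_conj V)).1 = 0.
Proof.
case=> A [uA -> Eg _].
rewrite -[LHS]/((oct_frame A (octmul g (pullback A (phi0 R))
  (octmul g (pullback A (phi0 R)) V (0, t)) (oct_conj V))).1).
rewrite !octmul_frame // oct_frame_conj.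
rewrite -[LHS]/(c0 (coord8 _)) !coord8_mul coord8_conj.
have : c0 (coord8 (oct_frame A (0, t))) = 0 by [].
case: (coord8 _) (coord8 _) => v0 v1 v2 v3 v4 v5 v6 v7 [t0 t1 t2 t3 t4 t5 t6 t7] /= ->.
by cbv [mul8 conj8 dot8 cross8 c0 c1 c2 c3 c4 c5 c6 c7]; ring.
Qed.

Lemma inner_sym phi g vol (u v : 'rV[R]_7) : G2_triple phi g vol ->
  inner g u v = inner g v u.
Proof.
case=> A [_ _ Eg _]; rewrite !(inner_frame _ _ Eg) !inner_euclidean_sum.
by apply: eq_bigr => i _; rewrite mulrC.
Qed.

Lemma cross_sumr g chi u (c : 'I_7 -> R) (v : 'I_7 -> 'rV[R]_7) :
  cross g chi u (\sum_b c b *: v b) = \sum_b c b *: cross g chi u (v b).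
Proof.
have cross0 : cross g chi u 0 = 0.
  by rewrite cross_sum big1 // => j _; rewrite big1 // => i _; rewrite mxE mul0r scale0r.
elim/big_rec2: _ => // b _ x _ <-; by rewrite cross_linearr.
Qed.

Lemma contract_delta k (t : tensor k.+1) (i : 'I_7) I :
  contract (delta_mx 0 i) t I = t [tuple of i :: I].
Proof.
rewrite /contract (bigD1 i) //= big1 => [|j /negPf nj]; rewrite mxE ?eqxx ?mul1r ?addr0 //.
by rewrite nj mul0r.
Qed.

(** Each product e^i T_i has real part - <e^i, T_i> and imaginary part e^i x T_i. Leaving chi free
    covers the torsions of both phi and sigma_V(phi). *)
Lemma sum_octmul_torsion g chi (T : tensor 2) :
  gram g \in unitmx -> (forall i j, g [tuple i; j] = g [tuple j; i]) ->
  \sum_i octmul g chi (0, row i (invmx (gram g))) (0, row i (endo_of g T)) =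
  (- trace g T, contract_torsion g T chi).
Proof.
move=> ug sg; set H := invmx (gram g).
have GT : (gram g)^T = gram g by apply/matrixP => i j; rewrite !mxE sg.
have HT : H^T = H by rewrite /H trmx_inv GT.
have HTE i j : H i j = H j i by rewrite -[in LHS]HT mxE.
have fst_sum (F : 'I_7 -> octonion R) : (\sum_i F i).1 = \sum_i (F i).1.
  by elim/big_rec2: _ => // i x y _ <-.
have snd_sum (F : 'I_7 -> octonion R) : (\sum_i F i).2 = \sum_i (F i).2.
  by elim/big_rec2: _ => // i x y _ <-.
apply: oct_eqP => [|c].
  rewrite fst_sum /= /trace -sumrN; apply: eq_bigr => i _.
  rewrite mul0r sub0r; congr (- _).
  rewrite /inner -row_mul mulVmx // row1 -rowE mxE mxE mxE.
  rewrite /endo_of -/H mxE; apply: eq_bigr => b _.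
  by rewrite !mxE mulrC HTE.
rewrite snd_sum summxE [RHS]mxE; apply: eq_bigr => i _.
rewrite octmul_imag [LHS]/=.
have -> : row i (endo_of g T) = \sum_b T [tuple i; b] *: row b H.
  rewrite /endo_of -/H row_mul; apply/rowP => k; rewrite mxE summxE.
  by apply: eq_bigr => b _; rewrite !mxE.
rewrite cross_sumr summxE; apply: eq_bigr => b _; rewrite mxE; congr (_ * _).
have -> : sharp g chi [tuple i; b; c] =
    contract (delta_mx 0 b) (contract (delta_mx 0 i) (pullback H chi)) [tuple c].
  by rewrite !contract_delta; congr (pullback H chi _); apply: val_inj.
rewrite !contract_pullback pullback_vector -!rowE /cross -/H mxE.
by apply: eq_bigr => k _; rewrite !mxE mulrC HTE.
Qed.

End TorsionAlgebra.

Lemma innerNr (R : realType) (g : cotensor R 7 2) (u v : 'rV[R]_7) :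
  inner g u (- v) = - inner g u v.
Proof. by rewrite -scaleN1r innerZr mulN1r. Qed.

Lemma nabla_oct_near (R : realType) (g : 'rV[R]_7 -> cotensor R 7 2) X
    (A B : 'rV[R]_7 -> octonion R) y :
  (\near y, A y = B y) -> nabla_oct g X A y = nabla_oct g X B y.
Proof.
move=> AB; rewrite /nabla_oct; congr pair.
  apply: eq_bigr => i _; congr (_ * _); apply: near_eq_derive.
  by apply: filterS AB => z ->.
apply/rowP => k; rewrite [LHS]mxE [RHS]mxE (nbhs_singleton AB); congr (_ + _).
apply: eq_bigr => i _; congr (_ * _); apply: near_eq_derive.
by apply: filterS AB => z ->.
Qed.

(** The cancellations after differentiating x(yV) = (x o y)V, with every product replaced by an
    atom: q is the torsion term of sigma_V(phi), and a1, a2, a4, a6 drop out. *)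
Lemma isolate_torsion_term (R : realType) (a1 a2 a3 a4 a5 a6 b c q : octonion R) :
  a1 + (a2 + a3 + (a4 - a5)) + (a6 - a4) = a1 + a2 + q + b + (a6 - c) ->
  q = - (b - c) - - (a3 - a5).
Proof.
move=> E; apply: oct_eqP => [|k].
  by have := congr1 fst E; rewrite !oct_compE; lra.
by have := congr1 (fun X : octonion R => X.2 0 k) E; rewrite !(oct_compE, mxE); lra.
Qed.

(** * The derivative of V in one coordinate direction of a chart *)

Section Pointwise.
Variables (R : realType) (U : set 'rV[R]_7) (y : 'rV[R]_7).
Hypotheses (openU : open U) (Uy : U y).
Local Notation tensor := (cotensor R 7).
Variables (phi : 'rV[R]_7 -> tensor 3) (g : 'rV[R]_7 -> tensor 2)
  (vol : 'rV[R]_7 -> tensor 7).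
Hypothesis triple : forall z, U z -> G2_triple (phi z) (g z) (vol z).
Hypothesis g_symU : forall z, U z -> forall i j, g z [tuple i; j] = g z [tuple j; i].
Variable a : 'I_7.
Local Notation e := (delta_mx 0 a : 'rV[R]_7).
Hypothesis g_derivable : forall i j, derivable (fun z => g z [tuple i; j]) y e.
Hypothesis phi_derivable : forall i j k, derivable (fun z => phi z [tuple i; j; k]) y e.
Variable V : 'rV[R]_7 -> octonion R.
Hypothesis V_derivable : derivable_section y a V.
Hypothesis V_unit : forall z, U z -> oct_norm2 (g z) (V z) = 1.
Variables t tt : 'rV[R]_7.
Local Notation phit := (fun z => sigma (g z) (vol z) (V z) (phi z)).
Hypothesis torsion_phi : forall i j k, nabla_cotensor g phi y a [tuple i; j; k] =
  2 * \sum_l t 0 l * dual4 (g y) (vol y) (phi y) [tuple l; i; j; k].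
Hypothesis torsion_phit : forall i j k, nabla_cotensor g phit y a [tuple i; j; k] =
  2 * \sum_l tt 0 l * dual4 (g y) (vol y) (phit y) [tuple l; i; j; k].

Lemma nearU (P : 'rV[R]_7 -> Prop) : (forall z, U z -> P z) -> \near y, P y.
Proof. by move=> UP; apply: filterS UP _; exact: open_nbhs_nbhs. Qed.

Lemma gram_unitU z : U z -> gram (g z) \in unitmx.
Proof. by move=> /triple [A [uA _ Eg _]]; apply: gram_frame_unit Eg. Qed.

Local Notation leibniz := (nabla_octmul g_derivable (nearU g_symU) (nearU gram_unitU)).

Lemma derivable_section_const (X : octonion R) : derivable_section y a (fun=> X).
Proof. by split=> [|k]; apply: derivable_cst. Qed.

Lemma derivable_section_conj A :
  derivable_section y a A -> derivable_section y a (fun z => oct_conj (A z)).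
Proof.
move=> [A1 A2]; split=> [|k] //=.
rewrite (_ : (fun z => _) = - (fun z => (A z).2 0 k)); first exact: derivableN.
by apply/funext => z; rewrite mxE.
Qed.

(** As |V| = 1, the product (e_i(e_j V)) times the conjugate of V is e_i o e_j; lowering its index
    gives the components of sigma_V(phi) as sums of differentiable products. *)
Lemma phit_derivable i j k : derivable (fun z => phit z [tuple i; j; k]) y e.
Proof.
pose F z := octmul (g z) (phi z)
  (octmul (g z) (phi z) (0, delta_mx 0 i) (octmul (g z) (phi z) (0, delta_mx 0 j) (V z)))
  (oct_conj (V z)).
have [_ F2] : derivable_section y a F.
  have C := derivable_section_const.
  have [D1 _] := leibniz (C (0, delta_mx 0 j)) V_derivable phi_derivable.
  have [D2 _] := leibniz (C (0, delta_mx 0 i)) D1 phi_derivable.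
  by have [D3 _] := leibniz D2 (derivable_section_conj V_derivable) phi_derivable.
apply: (@near_eq_derivable _ _ _ (fun z => \sum_l (F z).2 0 l * g z [tuple l; k])).
  apply: nearU => z Uz; rewrite /F (octmul_sigma _ _ (triple Uz) (V_unit Uz)).
  rewrite (octmulK _ _ (triple Uz)) V_unit // scale1r octmul_imag /=.
  rewrite crossE_lowered; set r := lowered_cross _ _ _.
  transitivity ((r *m invmx (gram (g z)) *m gram (g z)) 0 k).
    by rewrite [RHS]mxE; apply: eq_bigr => l _; rewrite [gram _ _ _]mxE.
  rewrite mulmxKV ?gram_unitU // /r mxE (bigD1 j) //= [X in _ + X]big1 => [|b /negPf nb];
    last by rewrite mxE eqxx nb mul0r.
  rewrite mxE !eqxx mul1r addr0 (bigD1 i) //= [X in _ + X]big1 => [|b /negPf nb];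
    last by rewrite mxE eqxx nb mul0r.
  by rewrite mxE !eqxx mul1r addr0.
by apply: derivable_bigsum => l; apply: derivableM.
Qed.

Local Notation D := (nabla_oct g e V y - octmul (g y) (phi y) (V y) (0, t)).

(** This real part is <D, V>. Metric compatibility makes <nabla V, V> half the derivative of |V|^2 =
    1, and V t is orthogonal to V. *)
Lemma real_part_derivative : (octmul (g y) (phi y) D (oct_conj (V y))).1 = 0.
Proof.
have G := triple Uy.
rewrite octmulBl oct_compE
  -[(- octmul _ _ _ _).1]/(- (octmul _ _ _ _).1) (octmul_conj_real _ _ G) oppr0 addr0.
have [V1 V2] := V_derivable.
have HV : mx_derive y e (fun z => (V z).2) (\row_k 'D_e (fun z => (V z).2 0 k) y).
  by move=> i k; rewrite mxE (ord1 i); apply: derivableP.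
have Hi := nabla_inner g_derivable (nearU g_symU) (nearU gram_unitU) HV HV.
have HV1 := derivableP V1.
have H := is_derive_add (is_derive_mul HV1 HV1) Hi.
have : 'D_e (fun z => (V z).1 * (V z).1 + inner (g z) (V z).2 (V z).2) y = 0.
  rewrite -[RHS](derive_cst (1 : R) y e); apply: near_eq_derive.
  by apply: nearU => z Uz; rewrite -expr2; apply: V_unit.
have [_ ->] := H; rewrite -(nabla_vectorE g HV).
rewrite (inner_sym (V y).2 _ G) /octmul /= /oct_conj /=.
have -> : nabla_fun e (fun z => (V z).1) y = 'D_e (fun z => (V z).1) y.
  rewrite /nabla_fun (bigD1 a) //= mxE !eqxx mul1r big1 ?addr0 // => i /negPf ni.
  by rewrite mxE ni andbF mul0r.
rewrite innerNr; set x := inner _ _ _; set d := 'D_e _ y; lra.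
Qed.

Lemma derivative_torsion : D = - octmul (g y) (phi y) (0, tt) (V y).
Proof.
have G := triple Uy; have nV := V_unit Uy; have Gt := G2_triple_sigma G nV.
have ug := gram_unitU Uy.
pose mul := octmul (g y) (phi y); pose mult := octmul (g y) (phit y).
(* The candidate for tt: right multiplication by V gives back -D, and [real_part_derivative] makes W
   imaginary. *)
pose W := - mul D (oct_conj (V y)).
have WV : mul W (V y) = - D.
  by rewrite /W /mul octmulNl (octmulVK _ _ G) nV scale1r.
have W0 : W = (0, W.2).
  have : W.1 = 0 by rewrite /W oct_compE /mul real_part_derivative oppr0.
  by case: W {WV} => w1 w2 /= ->.
have sig X Y : mul X (mul Y (V y)) = mul (mult X Y) (V y) by apply: octmul_sigma.
suff Ett : tt = W.2.
  by rewrite Ett -W0 -/mul WV opprK.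
(* By injectivity for sigma_V(phi), it is enough that tt and W have the same associators with all x
   and z. *)
apply/eqP; rewrite -subr_eq0; apply/eqP; apply: (associator4_inj Gt) => x z.
rewrite associator4B; apply/eqP; rewrite subr_eq0; apply/eqP.
have two0 : (2 : R) != 0 by rewrite pnatr_eq0.
apply: (scalerI two0).
pose X : octonion R := (0, x); pose Y : octonion R := (0, z).
suff : (0, 2 *: associator4 (g y) (dual4 (g y) (vol y) (phit y)) tt x z) =
       (0, 2 *: associator4 (g y) (dual4 (g y) (vol y) (phit y)) W.2 x z) :> octonion R.
  by case.
apply: (octmul_cancel G nV).
rewrite -(octmul_assoc X Y W.2 Gt) -W0 -/mul -/mult.
pose B (A A' : octonion R) := mul (mul A A') (0, t) - mul A (mul A' (0, t)).
have EB (A A' : octonion R) :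
    (0, cross (g y) (nabla_cotensor g phi y a) A.2 A'.2) = B A A'.
  by rewrite (cross_torsion _ _ _ torsion_phi) -(octmul_assoc _ _ _ G).
rewrite -(cross_torsion _ _ _ torsion_phit).
have CX := derivable_section_const X; have CY := derivable_section_const Y.
have [D1 L1] := leibniz CY V_derivable phi_derivable.
have [D2 L2] := leibniz CX D1 phi_derivable.
have [D3 L3] := leibniz CX CY phit_derivable.
have [D4 L4] := leibniz D3 V_derivable phi_derivable.
(* X and Y have constant components but need not be parallel; the terms in X' and Y' are equal on
   both sides and cancel. *)
set X' := nabla_oct g e (fun=> X) y in L2 L3.
set Y' := nabla_oct g e (fun=> Y) y in L1 L3.
set V' := nabla_oct g e V y in L1 L4 WV.
set Q : octonion R := (0, cross _ _ x z).
have Lsame : nabla_oct g e (fun w => octmul (g w) (phi w) X (octmul (g w) (phi w) Y (V w))) y =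
  nabla_oct g e (fun w => octmul (g w) (phi w) (octmul (g w) (phit w) X Y) (V w)) y.
  have same w : U w -> octmul (g w) (phi w) X (octmul (g w) (phi w) Y (V w)) =
      octmul (g w) (phi w) (octmul (g w) (phit w) X Y) (V w).
    by move=> Uw; apply: octmul_sigma (triple Uw) (V_unit Uw).
  by apply: nabla_oct_near; apply: nearU => w; apply: same.
move: Lsame; rewrite L2 L4 L1 L3 !EB -/Q; rewrite -/mul -/mult => Lsame.
have mulD1 P P' S : mul (P + P') S = mul P S + mul P' S by apply: octmulDl.
have mulD2 P S S' : mul P (S + S') = mul P S + mul P S' by apply: octmulDr.
have mulB2 P S S' : mul P (S - S') = mul P S - mul P S' by apply: octmulBr.
have mulN2 P S : mul P (- S) = - mul P S by apply: octmulNr.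
have mulB1 P P' S : mul (P - P') S = mul P S - mul P' S by apply: octmulBl.
pose T : octonion R := (0, t).
(* Once the associators with T are expanded, the surviving products with V T join the derivative of
   V to form D on both sides. *)
have B1 : mul X (B Y (V y)) =
  mul X (mul (mul Y (V y)) T) - mul X (mul Y (mul (V y) T)) by apply: mulB2.
have B2 : B X (mul Y (V y)) =
  mul (mul X (mul Y (V y))) T - mul X (mul (mul Y (V y)) T) by [].
have B3 : B (mult X Y) (V y) =
  mul (mul (mult X Y) (V y)) T - mul (mult X Y) (mul (V y) T) by [].
move: B1 B2 B3 Lsame.
move: (B Y (V y)) (B X (mul Y (V y))) (B (mult X Y) (V y)) => b1 b2 b3 B1 B2 B3 E.
rewrite !mulD1 !mulD2 B1 B2 B3 !sig in E.
rewrite mulB1 -(sig (mult X Y) W) -(sig X (mult Y W)) -(sig Y W) WV !mulN2 !mulB2.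
apply: isolate_torsion_term E.
Qed.

End Pointwise.

(** * From charts to the manifold *)

Lemma smooth_on_derivable (R : realType) n (U : set 'rV[R]_n) f y i :
  smooth_on U f -> U y -> derivable f y (delta_mx 0 i).
Proof. by move=> /(_ 1%N) [_ /(_ i) [h _]] /h. Qed.

Lemma nabla_oct_one (R : realType) (g : 'rV[R]_7 -> cotensor R 7 2) X y :
  nabla_oct g X (fun=> (1, 0)) y = 0.
Proof.
have D0 (i : 'I_7) (c : R) : partial i (fun=> c) y = 0 by apply: derive_cst.
rewrite /nabla_oct /nabla_fun; congr pair.
  by rewrite big1 // => i _; rewrite D0 mulr0.
apply/rowP => k; rewrite !mxE /nabla_fun big1 ?add0r => [|i _].
  by rewrite big1 // => i _; rewrite big1 // => j _; rewrite mxE mulr0.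
by rewrite [X in _ * X]D0 mulr0.
Qed.

Lemma torsion_octonionE (R : realType) (g T : cotensor R 7 2) (phi : cotensor R 7 3) :
  (7 * tau1 g T, - 6 *: tau7 g T phi) = (trace g T, - contract_torsion g T phi).
Proof.
rewrite /tau1 /tau7 scalerA mulrA mulNr !divff ?pnatr_eq0 // mul1r.
by rewrite scaleN1r.
Qed.

Theorem theorem9p3 (R : realType) (M : smooth_manifold R 7)
    (phi : cotensor_field M 3) (g : cotensor_field M 2)
    (vol : cotensor_field M 7) (T : cotensor_field M 2) :
  is_G2_structure phi ->
  is_G2_metric phi g vol ->
  is_torsion g vol phi T ->
  (forall V : octonion_field M,
     is_octonion_section V ->
     is_unit_section g V ->
     forall Tt : cotensor_field M 2,
       is_torsion g vol (sigma_field g vol V phi) Tt ->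
       same_section (dirac_field g phi T V)
         (octmul_field g phi
            (torsion_octonion g Tt (sigma_field g vol V phi)) V)) /\
  same_section (dirac_field g phi T (@one_section R M))
    (torsion_octonion g T phi).
Proof.
move=> [[[phi_smooth _] _] phi_pos] [[g_smooth _] _ metric] [_ torsion_phi].
have triple c z : codom_chart c z -> G2_triple (phi c z) (g c z) (vol c z).
  by move=> cz; have [ip uv me] := metric c z cz; apply: G2_tripleP (phi_pos c z cz) ip uv me.
have g_sym c z : codom_chart c z -> forall i j, g c z [tuple i; j] = g c z [tuple j; i].
  by move=> cz; have [[gs _] _ _] := metric c z cz.
have ug c z : codom_chart c z -> gram (g c z) \in unitmx.
  by move=> /triple [A [uA _ Eg _]]; apply: gram_frame_unit Eg.
split; last first.
  (* The section 1 is parallel, so D_i 1 = - T_i and the sum over i is minus the contracted torsion,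
     with no change of G2-form. *)
  move=> c y cy; rewrite /dirac_field /dirac /torsion_octonion torsion_octonionE.
  under eq_bigr => i _ do
    rewrite /oct_derivative nabla_oct_one sub0r octmul1l -rowE octmulNr.
  rewrite sumrN (sum_octmul_torsion _ _ (ug c y cy) (g_sym c y cy)).
  by apply: oct_eqP => [|k]; rewrite !oct_compE /= ?opprK.
move=> V [V1 V2 _] V_unit Tt [_ torsion_phit] c y cy.
rewrite /dirac_field /octmul_field /dirac /torsion_octonion torsion_octonionE.
have Dirac i : oct_derivative (g c) (phi c) (T c) (delta_mx 0 i) (V c) y =
    - octmul (g c y) (phi c y) (0, row i (endo_of (g c y) (Tt c y))) (V c y).
  rewrite /oct_derivative; refine (@derivative_torsion R (codom_chart c) y
    (@coord_dom_open R 7 M c) cy (phi c) (g c) (vol c) (triple c) (g_sym c) i _ _ (V c) _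
    (V_unit c) (delta_mx 0 i *m endo_of (g c y) (T c y))
    (row i (endo_of (g c y) (Tt c y))) _ _).
  - by move=> j k; apply: smooth_on_derivable cy.
  - by move=> j k l; apply: smooth_on_derivable cy.
  - by split=> [|k]; apply: smooth_on_derivable cy.
  - move=> j k l; rewrite torsion_phi //; congr (_ * _); apply: eq_bigr => b _.
    by rewrite -rowE [in RHS]mxE.
  - move=> j k l; rewrite (torsion_phit c y cy); congr (_ * _); apply: eq_bigr => b _.
    by rewrite [in RHS]mxE.
under eq_bigr => i _ do
  rewrite Dirac octmulNr (octmul_sigma _ _ (triple c y cy) (V_unit c y cy)).
rewrite sumrN -octmul_suml (sum_octmul_torsion _ _ (ug c y cy) (g_sym c y cy)) -octmulNl.
congr octmul; apply: oct_eqP => [|k]; rewrite !oct_compE /= ?opprK //.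
Qed.
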